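(* Let $\Phi$ be an aperiodic graphing on a standard probability space $(X,\mu)$. Then for every closed normal subgroup $N$ of $\overline{D([\Phi]_1)}$ there is a (unique up to measure zero) $\Phi$-invariant Borel set $A\subseteq X$ such that $$N=\overline{D([\Phi]_1)}_A.$$
   Context: A standard probability space $(X,\mu)$ is a standard Borel space with a non-atomic Borel probability measure; everything is up to null sets. $\mathrm{Aut}(X,\mu)$ is the group of measure-preserving Borel bijections of $X$ modulo a.e. equality. A partial isomorphism is a measure-preserving Borel bijection $\varphi:\mathrm{dom}\,\varphi\to\mathrm{rng}\,\varphi$ between Borel subsets of $X$. A graphing $\Phi$ is a countable set of partial isomorphisms; it generates the equivalence relation $\mathcal R_\Phi$, the smallest one containing all $(x,\varphi(x))$ with $\varphi\in\Phi$, $x\in\mathrm{dom}\,\varphi$. $\Phi$ is aperiodic if almost every $\mathcal R_\Phi$-class is infinite. A Borel set is $\Phi$-invariant if it is a union of $\mathcal R_\Phi$-classes (up to a null set). On $\mathcal R_\Phi$-classes put $d_\Phi(x,y)=\min\{n:\exists\varphi_1,\dots,\varphi_n\in\Phi\cup\Phi^{-1},\ y=\varphi_n\cdots\varphi_1(x)\}$. The full group is $[\mathcal R_\Phi]=\{T\in\mathrm{Aut}(X,\mu):(x,T(x))\in\mathcal R_\Phi\text{ a.e.}\}$ and the $\mathrm L^1$ full group is $[\Phi]_1=\{T\in[\mathcal R_\Phi]:\int_Xd_\Phi(x,T(x))\,d\mu<+\infty\}$, with the topology induced by the metric $\tilde d_\Phi(S,T)=\int_Xd_\Phi(S(x),T(x))\,d\mu(x)$.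 $D(G)$ denotes the derived subgroup of $G$, and $\overline{D([\Phi]_1)}$ is the closure in $[\Phi]_1$. For a subgroup $G\le\mathrm{Aut}(X,\mu)$ and Borel $A\subseteq X$, $G_A=\{T\in G:\mathrm{supp}\,T\subseteq A\}$, where $\mathrm{supp}\,T=\{x:T(x)\ne x\}$. *)

(* Defs.v *)
From HB Require Import structures.
From Stdlib Require Import Relation_Operators.
From mathcomp Require Import all_boot all_order all_algebra.
From mathcomp Require Import all_classical all_reals all_analysis.

Set Implicit Arguments.
Unset Strict Implicit.
Unset Printing Implicit Defensive.

Import Order.TTheory GRing.Theory Num.Theory.
Import numFieldNormedType.Exports.

Local Open Scope classical_set_scope.
Local Open Scope ring_scope.
Local Open Scope quotient_scope.

(* [T] is Borel isomorphic to a Polish space. *)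
Definition standard_borel (R : realType) d (T : measurableType d) : Prop :=
  exists (P : completePseudoMetricType R) (f : T -> P),
    [/\ hausdorff_space P,
        exists2 D : set P, countable D & dense D,
        bijective f &
        @measurable d T = preimage_set_system setT f <<s @open P >>].

Definition non_atomic d (T : measurableType d) (R : realType)
    (mu : {measure set T -> \bar R}) : Prop :=
  forall A, measurable A -> (0 < mu A)%E ->
    exists B, [/\ measurable B, B `<=` A & (0 < mu B < mu A)%E].

Section mp_bijection.
Context d (T : measurableType d) (R : realType) (mu : probability T R).

Record mp_bijection := MpBijection {
  mp_fun :> T -> T;
  mp_inv : T -> T;
  mp_funK : cancel mp_fun mp_inv;
  mp_invK : cancel mp_inv mp_fun;
  measurable_mp_fun : measurable_fun setT mp_fun;
  measurable_mp_inv : measurable_fun setT mp_inv;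
  mp_preserve : forall A, measurable A -> mu (mp_fun @^-1` A) = mu A }.

HB.instance Definition _ := gen_eqMixin mp_bijection.
HB.instance Definition _ := gen_choiceMixin mp_bijection.

Let preimage_mp_fun S A : measurable A -> measurable (mp_fun S @^-1` A).
Proof. by rewrite -[_ @^-1` _]setTI => ?; exact: measurable_mp_fun. Qed.

Definition mp_id : mp_bijection :=
  @MpBijection id id (fun=> erefl) (fun=> erefl)
    (@measurable_id _ _ _) (@measurable_id _ _ _) (fun _ _ => erefl).

Let comp_preserve (S U : mp_bijection) A :
  measurable A -> mu ((S \o U) @^-1` A) = mu A.
Proof.
by move=> mA; rewrite comp_preimage !mp_preserve//; exact: preimage_mp_fun.
Qed.

Definition mp_comp (S U : mp_bijection) : mp_bijection :=
  @MpBijection (S \o U) (mp_inv U \o mp_inv S)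
    (can_comp (@mp_funK S) (@mp_funK U)) (can_comp (@mp_invK U) (@mp_invK S))
    (measurableT_comp (measurable_mp_fun S) (measurable_mp_fun U))
    (measurableT_comp (measurable_mp_inv U) (measurable_mp_inv S))
    (@comp_preserve S U).

Let inv_preserve (S : mp_bijection) A :
  measurable A -> mu (mp_inv S @^-1` A) = mu A.
Proof.
move=> mA; rewrite -[LHS](mp_preserve S); last first.
  by rewrite -[_ @^-1` _]setTI; exact: measurable_mp_inv.
by congr (mu _); apply/seteqP; split=> x /=; rewrite mp_funK.
Qed.

Definition mp_sym (S : mp_bijection) : mp_bijection :=
  @MpBijection (mp_inv S) S (@mp_invK S) (@mp_funK S)
    (measurable_mp_inv S) (measurable_mp_fun S) (@inv_preserve S).

Definition mp_ae_eq (S U : mp_bijection) : bool :=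
  `[< {ae mu, forall x, S x = U x} >].

Let mp_ae_eq_refl : reflexive mp_ae_eq.
Proof. by move=> S; apply/asboolP; apply: aeW. Qed.

Let mp_ae_eq_sym : symmetric mp_ae_eq.
Proof.
by move=> S U; apply/asboolP/asboolP; apply: filterS => x ->.
Qed.

Let mp_ae_eq_trans : transitive mp_ae_eq.
Proof.
move=> S U V /asboolP US /asboolP SV; apply/asboolP.
by apply: filterS2 US SV => x -> ->.
Qed.

Canonical mp_ae_eq_canonical :=
  EquivRel mp_ae_eq mp_ae_eq_refl mp_ae_eq_sym mp_ae_eq_trans.

Definition Aut : Type := {eq_quot mp_ae_eq}.
HB.instance Definition _ := Choice.on Aut.
HB.instance Definition _ := EqQuotient.on Aut.

(* The value of a class at a point depends on the chosen representative, so it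
   is only meaningful up to null sets. *)
Definition Aut_fun (S : Aut) : T -> T := repr S.

End mp_bijection.

Coercion Aut_fun : Aut >-> Funclass.

Section Aut_group.
Context d (T : measurableType d) (R : realType) (mu : probability T R).
Implicit Types (S U V : Aut mu) (f g : mp_bijection mu).

Lemma ae_mp_preimage f (P : T -> Prop) :
  {ae mu, forall x, P x} -> {ae mu, forall x, P (f x)}.
Proof.
move=> [N [mN N0 PN]]; exists (f @^-1` N); split.
- by rewrite -[_ @^-1` _]setTI; exact: measurable_mp_fun.
- by rewrite mp_preserve.
- by move=> x /= nP; exact: PN.
Qed.

Lemma AutP S U : S = U <-> {ae mu, forall x, S x = U x}.
Proof.
split=> [->|SU]; first exact: aeW.
by rewrite -[S]reprK -[U]reprK; apply/eqmodP/asboolP.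
Qed.

Lemma Aut_piE f : {ae mu, forall x, (\pi_(Aut mu) f : Aut mu) x = f x}.
Proof.
have /eqmodP/asboolP := reprK (\pi_(Aut mu) f : Aut mu).
exact.
Qed.

Definition Aut_one : Aut mu := \pi_(Aut mu) (mp_id mu).
Definition Aut_mul S U : Aut mu := \pi_(Aut mu) (mp_comp (repr S) (repr U)).
Definition Aut_inv S : Aut mu := \pi_(Aut mu) (mp_sym (repr S)).

Let oneE : {ae mu, forall x, Aut_one x = x}.
Proof. exact: Aut_piE. Qed.

Let mulE S U : {ae mu, forall x, Aut_mul S U x = S (U x)}.
Proof. exact: Aut_piE. Qed.

Let invE S : {ae mu, forall x, Aut_inv S x = mp_inv (repr S) x}.
Proof. exact: Aut_piE. Qed.

Let mulA : associative Aut_mul.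
Proof.
move=> S U V; apply/AutP.
move: (mulE S (Aut_mul U V)) (mulE U V) => h1 h2.
move: (mulE (Aut_mul S U) V) (ae_mp_preimage (repr V) (mulE S U)) => h3 h4.
have h34 : {ae mu, forall x, Aut_mul (Aut_mul S U) V x = S (U (V x))}.
  by apply: filterS2 h3 h4 => x ->.
by apply: filterS3 h1 h2 h34 => x -> -> ->.
Qed.

Let mul1 : left_id Aut_one Aut_mul.
Proof.
move=> S; apply/AutP.
move: (mulE Aut_one S) (ae_mp_preimage (repr S) oneE).
by apply: filterS2 => x -> h; exact: h.
Qed.

Let mulo : right_id Aut_one Aut_mul.
Proof.
move=> S; apply/AutP; move: (mulE S Aut_one) oneE.
by apply: filterS2 => x -> ->.
Qed.

Let mulV : left_inverse Aut_one Aut_inv Aut_mul.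
Proof.
move=> S; apply/AutP; move: (mulE (Aut_inv S) S) oneE.
move: (ae_mp_preimage (repr S) (invE S)).
by apply: filterS3 => x h1 -> ->; rewrite [LHS]h1 mp_funK.
Qed.

Let mulVr : right_inverse Aut_one Aut_inv Aut_mul.
Proof.
move=> S; apply/AutP; move: (mulE S (Aut_inv S)) oneE (invE S).
by apply: filterS3 => x -> -> ->; rewrite /Aut_fun mp_invK.
Qed.

HB.instance Definition _ := isGroup.Build (Aut mu) mulA mul1 mulo mulV mulVr.

Lemma Aut_mulE S U : {ae mu, forall x, ((S * U)%g : Aut mu) x = S (U x)}.
Proof. exact: mulE. Qed.

End Aut_group.

Definition derived_subgroup (G : groupType) (H : set G) : set G :=
  smallest (fun K : set G => group_closed (mem K))
    [set [~ x, y]%g | x in H & y in H].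

Definition normal_subgroup_of (G : groupType) (N H : set G) : Prop :=
  [/\ group_closed (mem N), N `<=` H &
      forall x y, N x -> H y -> N (x ^ y)%g].

Section partial_iso.
Context d (T : measurableType d) (R : realType) (mu : probability T R).

(* The values of [pi_fun] outside [pi_dom] are irrelevant; measurability of the
   inverse [pi_rng -> pi_dom] is stated through images under [pi_fun]. *)
Record partial_iso := PartialIso {
  pi_dom : set T;
  pi_rng : set T;
  pi_fun :> T -> T;
  measurable_pi_dom : measurable pi_dom;
  measurable_pi_rng : measurable pi_rng;
  pi_bij : set_bij pi_dom pi_rng pi_fun;
  measurable_pi_fun : measurable_fun pi_dom pi_fun;
  measurable_pi_image : forall A, measurable A -> A `<=` pi_dom ->
    measurable (pi_fun @` A);
  pi_preserve : forall A, measurable A -> A `<=` pi_dom ->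
    mu (pi_fun @` A) = mu A }.

Definition is_graphing (Phi : set partial_iso) : Prop := countable Phi.

End partial_iso.

Section graphing.
Context d (T : measurableType d) (R : realType) (mu : probability T R).
Variable Phi : set (partial_iso mu).
Implicit Types (A : set T) (H : set (Aut mu)).

Definition pi_step (x y : T) : Prop :=
  exists2 phi, Phi phi & pi_dom phi x /\ y = phi x.

Definition orbit_rel : T -> T -> Prop := clos_refl_sym_trans T pi_step.

Definition aperiodic : Prop :=
  {ae mu, forall x, infinite_set [set y | orbit_rel x y]}.

Definition graphing_invariant A : Prop :=
  exists2 B : set T, (forall x y, orbit_rel x y -> B x -> B y) &
    {ae mu, forall x, A x <-> B x}.

(* [y] is the image of [x] under a word of length [n] in the elements of [Phi]
   and their inverses. *)
Fixpoint word_rel (n : nat) (x y : T) : Prop :=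
  if n is m.+1 then
    exists2 z, pi_step x z \/ pi_step z x & word_rel m z y
  else y = x.

(* Takes the value +oo on points in different classes. *)
Definition word_dist (x y : T) : \bar R :=
  ereal_inf [set (n%:R)%:E | n in [set n | word_rel n x y]].

Definition full_group : set (Aut mu) :=
  [set S | {ae mu, forall x, orbit_rel x (S x)}].

Definition L1_full_group : set (Aut mu) :=
  [set S | full_group S /\ (\int[mu]_x word_dist x (S x) < +oo)%E].

Definition L1_dist (S U : Aut mu) : \bar R :=
  (\int[mu]_x word_dist (S x) (U x))%E.

Definition L1_closure H : set (Aut mu) :=
  [set S | L1_full_group S /\
    forall e : R, 0 < e -> exists2 U, H U & (L1_dist U S < e%:E)%E].

Definition L1_closed_in (N H : set (Aut mu)) : Prop :=
  L1_closure N `&` H `<=` N.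

End graphing.

Definition supp d (T : measurableType d) (R : realType)
    (mu : probability T R) (S : Aut mu) : set T :=
  [set x | S x <> x].

Definition supported_in d (T : measurableType d) (R : realType)
    (mu : probability T R) (G : set (Aut mu)) (A : set T) : set (Aut mu) :=
  [set S | G S /\ {ae mu, forall x, supp S x -> A x}].

(* Main.v *)
From Stdlib Require Import Relation_Operators.
From mathcomp Require Import fingroup perm gseries alt.
From mathcomp Require Import all_boot all_order all_algebra.
From mathcomp Require Import all_classical all_reals all_analysis.
From mathcomp Require Import measurable_realfun.
From mathcomp Require Import ring.
Require Import Defs.

(** Write H for the L1 full group of Phi, G for the closure of its derived
    subgroup, F for the subgroup of H generated by involutions and P for the
    closure of F in H. The proof rests on three facts.

    First, G is contained in P: two elements S and U of H commute modulo P. A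
    marker of S is a set M disjoint from S M that is at most one step away from
    every point moved by S. Multiplying S by involutions turns it into an element
    supported on M, or on S M. Similarly U is turned, by shortcutting its
    excursions into M, into an element that is almost trivial on M, hence almost
    commutes with S; only the points whose whole orbit under U stays in M resist,
    and there one uses the element supported on S M instead. The lemmas are
    [exists_marker], [exists_shortcut], [commutator_disp] and [congr_inv_comm].

    Second, if S in N displaces a non-null set C and v is an involution of H
    displacing C, then N contains the restriction of v to some non-null invariant
    set contained in the union of C and v C. Indeed aperiodicity makes almost
    every orbit that meets C return to it, which provides disjoint copies of a
    small set inside C, permuted by elements of H. If U and V permute such copies,
    then [[S, U], V] = [U, V], so that N meets the alternating group on the
    copies; that group being simple, it lies in N. See [exists_return],
    [comm_in_normal] and [small_swap_in_normal].

    Third, an exhaustion argument, using that N is closed, upgrades this: N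
    contains every involution of H supported in the essential union A0 of the
    supports of its elements ([involution_in_normal]), and A0 is invariant up to a
    null set ([ess_support_word]). Let A be the saturation of A0. An element of G
    supported in A is a limit of products of involutions by the first fact;
    cutting these involutions to A gives elements of N, and they still converge
    ([supported_in_sub]). Thus N consists of the elements of G supported in A.
    The set A is unique because every non-null set carries a nontrivial element of
    G ([exists_supported_nontrivial]).

    Throughout, the graphing is replaced by a countable family of globally
    defined involutions with the same orbits, so that words in the graphing become
    measure-preserving bijections of the whole space. *)

Set Implicit Arguments.
Unset Strict Implicit.
Unset Printing Implicit Defensive.
Import Order.TTheory GRing.Theory Num.Theory.
Import numFieldNormedType.Exports.
Local Open Scope classical_set_scope.
Local Open Scope ring_scope.

(** * Separation of points *)

Section separation.
Context (R : realType) d (T : measurableType d).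

Definition separating (B : (set T)^nat) : Prop :=
  (forall k, measurable (B k)) /\
  forall x y, x <> y -> exists k, B k x /\ ~ B k y.

(** This is the only use of the standard Borel structure: a countable base
    separates points, hence two measurable maps coincide on a measurable set. *)
Lemma standard_borel_separating :
  standard_borel R T -> exists B, separating B.
Proof.
move=> [P [f [hP [D cD dD] bf mE]]].
have fI : injective f by exact: bij_inj.
have mf (A : set P) : open A -> measurable (f @^-1` A).
  by move=> oA; rewrite mE -[_ @^-1` _]setTI; exists A => //; exact: sub_sigma_algebra.
move: (cD) => /pfcard_geP [D0|[e]].
  exists (fun=> set0); split => // x y _; exfalso.
  have [] := dD setT; first by exists (f x).
    exact: openT.
  by move=> z []; rewrite D0.
pose B k := if unpickle k is Some (i, n)
  then f @^-1` (ball (e i : P) (n.+1%:R^-1 : R))° else set0.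
exists B; split.
  move=> k; rewrite /B; case: (unpickle k) => [[i n]|//].
  exact/mf/open_interior.
move=> x y /eqP xy.
have fxy : f x != f y by apply: contra xy => /eqP/fI->.
move: hP; rewrite open_hausdorff => /(_ _ _ fxy) [[A A']] /=.
rewrite !inE => -[Ax A'y] [oA oA' AA'].
have /nbhs_ballP[r /= r0 rA] : nbhs (f x) A by exact: open_nbhs_nbhs.
pose n := Num.truncn (2 / r).
have nr : (n.+1%:R^-1 : R) < r / 2.
  rewrite -[ltRHS]invrK ltf_pV2 ?posrE ?invr_gt0 ?divr_gt0// invf_div.
  exact: truncnS_gt.
set q : R := n.+1%:R^-1 in nr.
have q0 : 0 < q by rewrite invr_gt0.
have q20 : 0 < q / 2 by rewrite divr_gt0.
have [z [zb Dz]] : (ball (f x) (q / 2))° `&` D !=set0.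
  apply: dD; last exact: open_interior.
  by exists (f x); apply: nbhsx_ballx.
have [i _ ei] := @surj _ _ _ _ e z Dz.
have bz : ball z (q / 2) (f x).
  by apply: ball_sym; exact: interior_subset zb.
exists (pickle (i, n)); rewrite /B pickleK ei; split.
  rewrite /= /interior; apply/nbhs_ballP; exists (q / 2) => //= t xt.
  by rewrite -/q (splitr q); exact: ball_triangle bz xt.
move=> /= /interior_subset zy.
have : ball (f x) r (f y).
  apply: (@le_ball _ _ _ (q / 2 + q)).
    apply/ltW; rewrite (splitr r) ltrD// (lt_trans _ nr)//.
    by rewrite gtr_pMr// invf_lt1// ltr1n.
  exact: ball_triangle (ball_sym bz) zy.
move=> /rA Ay; have : (A `&` A') (f y) by split.
by rewrite AA'.
Qed.

Lemma measurable_eqset (B : (set T)^nat) d' (T' : measurableType d') (f g : T' -> T) :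
  separating B -> measurable_fun setT f -> measurable_fun setT g ->
  measurable [set x | f x = g x].
Proof.
move=> [mB sB] mf mg.
have pre (h : T' -> T) A : measurable_fun setT h -> measurable A ->
    measurable (h @^-1` A).
  by move=> mh mA; rewrite -[_ @^-1` _]setTI; exact: mh.
rewrite (_ : [set _ | _] =
  ~` \bigcup_k (f @^-1` (B k) `&` g @^-1` (~` B k))).
  apply: measurableC; apply: bigcup_measurable => k _.
  by apply: measurableI; apply: pre => //; exact: measurableC.
apply/seteqP; split => x /=.
  by move=> fg [k _ [/= ]]; rewrite fg.
move=> nex; apply: contrapT => /sB [k [Bf nBg]].
by apply: nex; exists k.
Qed.

End separation.

(** * Gluing measure-preserving bijections *)

Section gluing.
Context d (T : measurableType d) (R : realType) (mu : probability T R).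

Definition image_preserving (D : set T) (f : T -> T) : Prop :=
  forall B, measurable B -> B `<=` D ->
    measurable (f @` B) /\ mu (f @` B) = mu B.

Lemma measurable_preimage (f : T -> T) (A : set T) :
  measurable_fun setT f -> measurable A -> measurable (f @^-1` A).
Proof. by move=> mf mA; rewrite -[_ @^-1` _]setTI; exact: mf. Qed.

Lemma measurable_mp_preimage (f : mp_bijection mu) (A : set T) :
  measurable A -> measurable (f @^-1` A).
Proof. exact/measurable_preimage/measurable_mp_fun. Qed.

Lemma image_mp (f : mp_bijection mu) (A : set T) : f @` A = mp_inv f @^-1` A.
Proof.
apply/seteqP; split => [_ [x Ax <-] /=|x Ax]; first by rewrite mp_funK.
by exists (mp_inv f x) => //; rewrite mp_invK.
Qed.

Lemma mp_inj (f : mp_bijection mu) : injective f.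
Proof. exact: can_inj (@mp_funK _ _ _ _ f). Qed.

Lemma mp_image_preserving (f : mp_bijection mu) : image_preserving setT f.
Proof.
move=> B mB _; rewrite image_mp; split.
  exact: (@measurable_mp_preimage (mp_sym f)).
exact: (mp_preserve (mp_sym f)).
Qed.

Lemma image_preservingS (D E : set T) (f : T -> T) :
  E `<=` D -> image_preserving D f -> image_preserving E f.
Proof. by move=> ED fD B mB BE; apply: fD => //; exact: subset_trans ED. Qed.

Lemma image_preserving_glue (f : T -> T) (E : (set T)^nat) :
  injective f -> (forall k, measurable (E k)) -> \bigcup_k E k = setT ->
  (forall k, image_preserving (E k) f) -> image_preserving setT f.
Proof.
move=> fI mE ET fE B mB _.
have mD k : measurable (B `&` seqDU E k).
  by apply: measurableI => //; exact: seqDU_measurable.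
have DE k : B `&` seqDU E k `<=` E k by move=> x [_ []].
have BE : B = \bigcup_k (B `&` seqDU E k).
  by rewrite -setI_bigcupr -seqDU_bigcup_eq ET setIT.
have fmD k : measurable (f @` (B `&` seqDU E k)).
  by have [] := fE k _ (mD k) (DE k).
split; first by rewrite BE image_bigcup; apply: bigcup_measurable.
have tD : trivIset setT (fun k => B `&` seqDU E k).
  exact/trivIset_setIl/trivIset_seqDU.
rewrite {1}BE image_bigcup measure_bigcup//; last first.
  move=> i j _ _ [_ [[x Dx <-] [y Dy]]] /fI yx; apply: tD => //.
  by exists x; split => //; rewrite -yx.
rewrite {2}BE measure_bigcup//; apply: eq_eseriesr => k _.
by have [] := fE k _ (mD k) (DE k).
Qed.

Lemma mp_of_image_preserving (f g : T -> T) :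
  cancel f g -> cancel g f ->
  image_preserving setT f -> image_preserving setT g ->
  exists F : mp_bijection mu, mp_fun F = f.
Proof.
move=> fK gK hf hg.
have fE A : f @^-1` A = g @` A.
  apply/seteqP; split => [x /= Ax|_ [x Ax <-]/=]; last by rewrite gK.
  by exists (f x).
have gE A : g @^-1` A = f @` A.
  apply/seteqP; split => [x /= Ax|_ [x Ax <-]/=]; last by rewrite fK.
  by exists (g x).
have mf : measurable_fun setT f.
  by move=> _ A mA; rewrite setTI fE; have [] := hg A mA (@subsetT _ _).
have mg : measurable_fun setT g.
  by move=> _ A mA; rewrite setTI gE; have [] := hf A mA (@subsetT _ _).
have pf A : measurable A -> mu (f @^-1` A) = mu A.
  by move=> mA; rewrite fE; have [] := hg A mA (@subsetT _ _).
by exists (MpBijection fK gK mf mg pf).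
Qed.

End gluing.

Section copies.
Context d (T : measurableType d) (R : realType) (mu : probability T R).

(** The maps need only make sense on C: this covers the pieces of a partial
    isomorphism as well as globally defined bijections. *)
Definition copies (I : finType) (C : set T) (h : I -> T -> T) : Prop :=
  [/\ measurable C, forall i, measurable_fun C (h i),
      forall i, image_preserving mu C (h i) &
      forall i j x y, C x -> C y -> h i x = h j y -> i = j /\ x = y].

Section permuting.
Variables (I : finType) (C : set T) (h : I -> T -> T).
Hypothesis hC : copies C h.

Definition permute_copies (s : {perm I}) (z : T) : T :=
  if pselect (exists p : I * T, C p.2 /\ h p.1 p.2 = z) is left e
  then let p := sval (cid e) in h (s p.1) p.2 else z.

Lemma permute_copiesE s i x :
  C x -> permute_copies s (h i x) = h (s i) x.
Proof.
move=> Cx; rewrite /permute_copies; case: pselect => [e|[]]; last first.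
  by exists (i, x).
case: cid => -[j y] /= [Cy hjy].
by have [_ _ _ hI] := hC; have [-> ->] := hI _ _ _ _ Cy Cx hjy.
Qed.

Lemma permute_copies_out s z :
  (forall i x, C x -> h i x <> z) -> permute_copies s z = z.
Proof.
move=> zC; rewrite /permute_copies; case: pselect => // -[[i x] [Cx hx]].
by exfalso; exact: zC hx.
Qed.

Lemma permute_copiesP z :
  (exists2 x, C x & exists i, h i x = z) \/ (forall i x, C x -> h i x <> z).
Proof.
have [[x Cx [i hz]]|nz] := pselect (exists2 x, C x & exists i, h i x = z).
  by left; exists x => //; exists i.
by right => i x Cx hz; apply: nz; exists x => //; exists i.
Qed.

Lemma permute_copiesM s t z :
  permute_copies (s * t)%g z = permute_copies t (permute_copies s z).
Proof.
have [[x Cx [i <-]]|zC] := permute_copiesP z.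
  by rewrite !permute_copiesE// permM.
by rewrite !permute_copies_out.
Qed.

Lemma permute_copies1 z : permute_copies 1%g z = z.
Proof.
have [[x Cx [i <-]]|zC] := permute_copiesP z; last exact: permute_copies_out.
by rewrite permute_copiesE// perm1.
Qed.

Lemma measurable_copy i : measurable (h i @` C).
Proof. by have [mC _ hp _] := hC; have [] := hp i C mC (@subset_refl _ _). Qed.

Lemma permute_copies_preserving s : image_preserving mu setT (permute_copies s).
Proof.
have [mC mh hp hI] := hC.
pose E k := if insub k : option 'I_#|I| is Some r then h (enum_val r) @` C
            else ~` \bigcup_(i in [set: I]) (h i @` C).
have mU : measurable (\bigcup_(i in [set: I]) (h i @` C)).
  apply: fin_bigcup_measurable; first exact: finite_finset.
  by move=> i _; exact: measurable_copy.
apply: (@image_preserving_glue _ _ _ _ _ E).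
- apply: (can_inj (g := permute_copies s^-1%g)) => z.
  by rewrite -permute_copiesM mulgV permute_copies1.
- move=> k; rewrite /E; case: insubP => [i _ _|_]; first exact: measurable_copy.
  exact: measurableC.
- apply/seteqP; split => // z _.
  have [[x Cx [i hz]]|zC] := permute_copiesP z.
    exists (enum_rank i : nat) => //; rewrite /E.
    case: insubP => [j _ /val_inj ->|]; first by rewrite enum_rankK; exists x.
    by rewrite ltn_ord.
  exists #|I| => //; rewrite /E insubN ?ltnn// => -[i _ [x Cx hz]].
  exact: zC hz.
- move=> k B mB; rewrite /E; case: insubP => [r _ _|_] BE.
    move: (enum_val r) BE => i BE.
    pose B' := C `&` h i @^-1` B.
    have mB' : measurable B' by exact: mh.
    have BB' : B = h i @` B'.
      apply/seteqP; split => [z Bz|_ [x [_ ?] <-]//].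
      have [x Cx hz] := BE _ Bz; exists x => //.
      by split => //; rewrite /= hz.
    have -> : permute_copies s @` B = h (s i) @` B'.
      rewrite BB' image_comp; apply: eq_imagel => x [Cx _] /=.
      by rewrite permute_copiesE.
    have B'C : B' `<=` C by move=> ? [].
    have [? ->] := hp (s i) _ mB' B'C; split => //.
    by rewrite [in RHS]BB'; have [_ ->] := hp i _ mB' B'C.
  have -> : permute_copies s @` B = B => //.
  rewrite -[RHS]image_id; apply: eq_imagel => z Bz.
  apply: permute_copies_out => i x Cx hz; apply: (BE _ Bz).
  by exists i => //; exists x.
Qed.

(** Composition of maps and the product of permutations run in opposite
    orders, so the representation of the symmetric group has to use the inverse
    permutation. *)
Lemma permute_copies_mp : exists rho : {perm I} -> mp_bijection mu,
  forall s, mp_fun (rho s) = permute_copies s^-1%g.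
Proof.
suff /choice[rho rhoE] : forall s : {perm I}, exists F : mp_bijection mu,
    mp_fun F = permute_copies s^-1%g by exists rho.
move=> s.
apply: (@mp_of_image_preserving _ _ _ _ _ (permute_copies s)).
- by move=> z; rewrite -permute_copiesM mulVg permute_copies1.
- by move=> z; rewrite -permute_copiesM mulgV permute_copies1.
- exact: permute_copies_preserving.
- exact: permute_copies_preserving.
Qed.

End permuting.

Lemma swap_mp (C : set T) (f : T -> T) :
  measurable C -> measurable_fun C f -> image_preserving mu C f ->
  {in C &, injective f} -> (forall x y, C x -> C y -> f x <> y) ->
  exists v : mp_bijection mu, [/\ forall x, C x -> v x = f x,
    forall x, C x -> v (f x) = x &
    forall z, ~ C z -> (forall x, C x -> f x <> z) -> v z = z].
Proof.
move=> mC mf hf fI fC.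
pose h (i : 'I_2) := if i == ord0 then id else f.
have hC : copies C h.
  split => //.
  - by move=> i; rewrite /h; case: ifP.
  - by move=> i; rewrite /h; case: ifP => // _ B mB _; rewrite image_id.
  - move=> i j x y Cx Cy; rewrite /h.
    have I2 (k l : 'I_2) : (k == ord0) = (l == ord0) -> k = l.
      by case: k => -[|[|//]] ? ; case: l => -[|[|//]] ? // _; apply/val_inj.
    case: ifPn => i0; case: ifPn => j0.
    + by move=> ->; split => //; apply: I2; rewrite i0 j0.
    + by move=> xy; have := fC y x Cy Cx (esym xy).
    + by move=> xy; have := fC x y Cx Cy xy.
    + move=> /fI; rewrite !inE => /(_ Cx Cy) ->; split => //.
      by apply: I2; rewrite (negbTE i0) (negbTE j0).
have [rho rhoE] := permute_copies_mp hC.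
have h0 x : h ord0 x = x by [].
have h1 x : h ord_max x = f x by [].
exists (rho (tperm ord0 ord_max)); rewrite rhoE tpermV; split.
- by move=> x Cx; rewrite -{1}[x]h0 permute_copiesE// tpermL.
- by move=> x Cx; rewrite -h1 permute_copiesE// tpermR.
- move=> z Cz fz; apply: permute_copies_out => // i x Cx; rewrite /h.
  by case: ifP => _ xz; [apply: Cz; rewrite -xz|exact: fz xz].
Qed.

End copies.

(** * Word distance and generating involutions *)

Section word_distance.
Context d (T : measurableType d) (R : realType) (mu : probability T R).
Variable Phi : set (partial_iso mu).
Local Notation D := (word_dist Phi).
Local Notation step := (pi_step Phi).

Lemma word_rel_cat m n x y z :
  word_rel Phi m x y -> word_rel Phi n y z -> word_rel Phi (m + n) x z.
Proof.
elim: m x => [x -> //|m IH x [u xu uy] yz]; rewrite addSn.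
by exists u => //; exact: IH.
Qed.

Lemma word_rel_sym n x y : word_rel Phi n x y -> word_rel Phi n y x.
Proof.
elim: n x y => [x y /= -> //|n IH x y [u xu uy]].
rewrite -addn1; apply: (word_rel_cat (IH _ _ uy)).
by exists x => //; case: xu; [right|left].
Qed.

Lemma word_rel_orbit n x y : word_rel Phi n x y -> orbit_rel Phi x y.
Proof.
elim: n x => [x ->|n IH x [u xu uy]]; first exact: rst_refl.
apply: rst_trans (IH _ uy); case: xu => xu; first exact: rst_step.
exact/rst_sym/rst_step.
Qed.

Lemma orbit_word_rel x y : orbit_rel Phi x y -> exists n, word_rel Phi n x y.
Proof.
elim => [u v uv|u|u v _ [n uv]|u v w _ [m uv] _ [n vw]].
- by exists 1%N; exists v => //; left.
- by exists 0%N.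
- by exists n; exact: word_rel_sym.
- by exists (m + n)%N; exact: word_rel_cat vw.
Qed.

Definition measurable_distance : Prop := forall f g : T -> T,
  measurable_fun setT f -> measurable_fun setT g ->
  measurable_fun setT (fun x => D (f x) (g x)).

Lemma word_dist_le n x y : word_rel Phi n x y -> (D x y <= n%:R%:E)%E.
Proof. by move=> xy; apply: ereal_inf_lbound; exists n. Qed.

Lemma word_distP x y :
  (exists2 n, word_rel Phi n x y & D x y = n%:R%:E) \/ D x y = +oo%E.
Proof.
have [[n nxy]|nxy] := pselect (exists n, word_rel Phi n x y); [left|right].
  have ex : exists n, `[< word_rel Phi n x y >] by exists n; apply/asboolP.
  case: (ex_minnP ex) => m /asboolP mxy mmin; exists m => //.
  apply/eqP; rewrite eq_le word_dist_le//=; apply: le_ereal_inf_tmp.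
  by move=> _ [k kxy <-]; rewrite lee_fin ler_nat; apply/mmin/asboolP.
have n0 : [set n | word_rel Phi n x y] = set0.
  by apply/seteqP; split => // n xy; apply: nxy; exists n.
by rewrite /word_dist n0 image_set0 ereal_inf0.
Qed.

Lemma word_dist_ge0 x y : (0 <= D x y)%E.
Proof. by case: (word_distP x y) => [[n _ ->]|-> //]; rewrite lee_fin. Qed.

Lemma word_distxx x : D x x = 0%E.
Proof.
by apply/eqP; rewrite eq_le word_dist_ge0 andbT; exact: (@word_dist_le 0).
Qed.

Lemma word_dist_sym x y : D x y = D y x.
Proof.
suff le u v : (D u v <= D v u)%E by apply/eqP; rewrite eq_le !le.
case: (word_distP v u) => [[n /word_rel_sym uv ->]|->]; last exact: leey.
exact: word_dist_le.
Qed.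

Lemma word_dist_triangle y x z : (D x z <= D x y + D y z)%E.
Proof.
have [[m xy ->]|->] := word_distP x y; last first.
  by rewrite addye ?leey// gt_eqF// (lt_le_trans _ (word_dist_ge0 y z)).
have [[n yz ->]|->] := word_distP y z; last by rewrite addey ?leey.
by rewrite -EFinD -natrD word_dist_le//; exact: word_rel_cat yz.
Qed.

Lemma word_dist_ge1 x y : x <> y -> (1 <= D x y)%E.
Proof.
move=> xy; have [[[|n] xyn ->]|->] := word_distP x y; last exact: leey.
  by move: xyn => /= yx; rewrite yx in xy.
by rewrite -[1%E]/((1%:R : R)%:E) lee_fin ler_nat.
Qed.

Lemma word_dist_orbit x y : (D x y < +oo)%E -> orbit_rel Phi x y.
Proof. by case: (word_distP x y) => [[n /word_rel_orbit]|->]. Qed.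

(** A graphing can be replaced by globally defined involutions moving points by
    at most one step: cut every partial isomorphism, outside its fixed points,
    into countably many pieces disjoint from their images, and swap each piece
    with its image.  Words in these involutions are measure-preserving
    bijections, so that the whole argument can avoid partial maps. *)
Definition generating_involutions (J : nat -> mp_bijection mu) : Prop :=
  [/\ forall n x, J n (J n x) = x,
      forall n x, [\/ J n x = x, step x (J n x) | step (J n x) x] &
      forall x y, step x y -> x <> y -> exists n, J n x = y].

Lemma partial_iso_preserving (phi : partial_iso mu) (C : set T) :
  C `<=` pi_dom phi -> image_preserving mu C phi.
Proof.
move=> CD B mB BC; have BD := subset_trans BC CD; split.
  exact: measurable_pi_image.
exact: pi_preserve.
Qed.

Lemma exists_generating_involutions (B : (set T)^nat) :
  separating B -> is_graphing Phi -> exists J, generating_involutions J.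
Proof.
move=> [mB sB] /countable_injP[e eI].
pose C (phi : partial_iso mu) k := pi_dom phi `&` (phi @^-1` (~` B k) `&` B k).
have swapC phi k : Phi phi -> exists v : mp_bijection mu,
    [/\ forall x, v (v x) = x,
        forall x, [\/ v x = x, step x (v x) | step (v x) x] &
        forall x, C phi k x -> v x = phi x].
  move=> Pphi; have [_ phiI _] := pi_bij phi.
  have CD : C phi k `<=` pi_dom phi by move=> ? [].
  have mphi := @measurable_pi_fun _ _ _ _ phi.
  have mD := measurable_pi_dom phi.
  have mC : measurable (C phi k).
    by rewrite /C setIA; apply: measurableI => //; apply: mphi => //; exact: measurableC.
  have [|||x y Cx [_ [_ By]] xy|v [v1 v2 v3]] := @swap_mp _ _ _ mu (C phi k) phi mC.
  - exact: measurable_funS mphi.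
  - exact: partial_iso_preserving.
  - move=> x y /[!inE] /CD Dx /CD Dy; apply: phiI; exact: mem_set.
  - by case: Cx => _ [/= + _]; rewrite xy.
  exists v; split => //.
    move=> x; have [Cx|nCx] := pselect (C phi k x); first by rewrite (v1 _ Cx) v2.
    have [[y Cy <-]|ny] := pselect (exists2 y, C phi k y & phi y = x).
      by rewrite v2// v1.
    have vx : v x = x by apply: v3 => // y Cy yx; apply: ny; exists y.
    by rewrite !vx.
  move=> x; have [Cx|nCx] := pselect (C phi k x).
    by constructor 2; exists phi => //; split; [exact: CD|rewrite v1].
  have [[y Cy <-]|ny] := pselect (exists2 y, C phi k y & phi y = x).
    by constructor 3; exists phi => //; rewrite v2//; split => //; exact: CD.
  by constructor 1; rewrite v3// => y Cy yx; apply: ny; exists y.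
have : forall n, exists v : mp_bijection mu,
    [/\ forall x, v (v x) = x,
        forall x, [\/ v x = x, step x (v x) | step (v x) x] &
        forall i k phi, unpickle n = Some (i, k) -> Phi phi -> e phi = i ->
        forall x, C phi k x -> v x = phi x].
  move=> n; case: (unpickle n) => [[i k]|]; last first.
    by exists (mp_id mu); split => // x; constructor 1.
  have [[phi [Pphi ephi]]|nphi] := pselect (exists phi, Phi phi /\ e phi = i).
    have [v [v1 v2 v3]] := swapC phi k Pphi; exists v; split => //.
    move=> _ _ psi [<- <-] Ppsi epsi.
    by have <- : phi = psi by apply: eI; rewrite ?inE// epsi.
  exists (mp_id mu); split => // [x|_ _ phi [<- <-] Pphi ephi].
    by constructor 1.
  by exfalso; apply: nphi; exists phi.
move=> /choice[J JP]; exists J; split.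
- by move=> n; have [] := JP n.
- by move=> n; have [] := JP n.
- move=> x y [phi Pphi [Dx ->]] xy; have [k [Bk nBk]] := sB _ _ xy.
  exists (pickle (e phi, k)); have [_ _ JE] := JP (pickle (e phi, k)).
  by rewrite (JE (e phi) k phi) ?pickleK.
Qed.

Definition word_mp (J : nat -> mp_bijection mu) (w : seq nat) :=
  foldr (fun n f => mp_comp (J n) f) (mp_id mu) w.

Lemma word_mp_cat J v w x : word_mp J (v ++ w) x = word_mp J v (word_mp J w x).
Proof. by elim: v => //= n v IH /=; rewrite IH. Qed.

Section words.
Variable J : nat -> mp_bijection mu.
Hypothesis hJ : generating_involutions J.
Local Notation gam := (word_mp J).

Lemma word_mp_rev w x : gam (rev w) (gam w x) = x.
Proof.
have [JK _ _] := hJ; elim: w x => [//|n w IH] x /=.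
by rewrite rev_cons -cats1 word_mp_cat /= JK IH.
Qed.

Lemma word_dist_word w x : (D x (gam w x) <= (size w)%:R%:E)%E.
Proof.
have [_ Jstep _] := hJ; elim: w => [|n w IH] /=; first by rewrite word_distxx.
rewrite (le_trans (word_dist_triangle (gam w x) _ _))// -addn1 natrD EFinD.
apply: leeD => //; case: (Jstep n (gam w x)) => [->|s|s].
- by rewrite word_distxx.
- by apply: (@word_dist_le 1); exists (J n (gam w x)) => //; left.
- by apply: (@word_dist_le 1); exists (J n (gam w x)) => //; right.
Qed.

Lemma word_rel_word n x y :
  word_rel Phi n x y -> exists2 w, (size w <= n)%N & y = gam w x.
Proof.
have [JK _ Jgen] := hJ; elim: n x => [x ->|n IH x [z xz zy]].
  by exists [::].
have [w wn ->] := IH _ zy.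
have [<-|nxz] := pselect (x = z); first by exists w => //; exact: leqW.
suff [k <-] : exists k, J k x = z.
  by exists (rcons w k); rewrite ?size_rcons// -cats1 word_mp_cat.
case: xz => xz; first exact: Jgen.
have [k <-] := Jgen _ _ xz (nesym nxz).
by exists k; rewrite JK.
Qed.

Lemma orbit_word x y : orbit_rel Phi x y <-> exists w, y = gam w x.
Proof.
split => [/orbit_word_rel[n] /word_rel_word[w _ ->]|[w ->]]; first by exists w.
apply: word_dist_orbit; rewrite (le_lt_trans (word_dist_word _ _))//.
by rewrite ltry.
Qed.

(** The distance is the least length of a word realizing it, an infimum over
    countably many words of functions constant on a coincidence set. *)
Lemma measurable_word_dist (B : (set T)^nat) d' (T' : measurableType d')
    (f g : T' -> T) :
  separating B -> measurable_fun setT f -> measurable_fun setT g ->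
  measurable_fun setT (fun x => D (f x) (g x)).
Proof.
move=> sB mf mg.
pose a k x := if unpickle k is Some w then
  if `[< gam w (f x) = g x >] then ((size w)%:R : R)%:E else +oo%E else +oo%E.
have ma k : measurable_fun setT (a k).
  rewrite /a; case: (unpickle k) => [w|]; last exact: measurable_cst.
  apply: measurable_fun_ifT; try exact: measurable_cst.
  apply: (measurable_fun_bool true); rewrite setTI.
  rewrite (_ : _ @^-1` _ = [set x | gam w (f x) = g x]); last first.
    by apply/seteqP; split => x /= /asboolP.
  apply: (measurable_eqset sB) => //.
  by apply: measurableT_comp => //; exact: measurable_mp_fun.
rewrite (_ : (fun x => D (f x) (g x)) = (fun x => einfs (a ^~ x) 0%N)).
  exact: measurable_fun_einfs.
apply/funext => x; rewrite /einfs /=; apply/eqP; rewrite eq_le; apply/andP; split.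
  apply: le_ereal_inf_tmp => _ [k _ <-]; rewrite /a; case: (unpickle k) => [w|].
    by case: asboolP => [<-|_]; rewrite ?leey// word_dist_word.
  by rewrite leey.
case: (word_distP (f x) (g x)) => [[n /word_rel_word[w wn wE] ->]|->]; last exact: leey.
apply: (@le_trans _ _ ((size w)%:R%:E)); last by rewrite lee_fin ler_nat.
apply: ereal_inf_lbound; exists (pickle w) => //.
by rewrite /a pickleK -wE; case: asboolP.
Qed.

End words.
End word_distance.

(** * Integrals and classes of bijections *)

Section integrals.
Context d (T : measurableType d) (R : realType) (mu : probability T R).
Local Open Scope ereal_scope.

Lemma integral_mp (f : mp_bijection mu) (F : T -> \bar R) :
  measurable_fun setT F -> (forall x, 0 <= F x) ->
  \int[mu]_x F (f x) = \int[mu]_x F x.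
Proof.
move=> mF F0; have mf := measurable_mp_fun f.
rewrite -[LHS](@ge0_integral_pushforward _ _ _ _ _ _ mf mu setT F)//.
by apply: eq_measure_integral => A mA _; exact: mp_preserve.
Qed.

Lemma integral_small (F : T -> \bar R) :
  measurable_fun setT F -> (forall x, 0 <= F x) -> \int[mu]_x F x < +oo ->
  forall e : R, (0 < e)%R -> exists2 r : R, (0 < r)%R &
  forall E, measurable E -> mu E < r%:E -> \int[mu]_(x in E) F x < e%:E.
Proof.
move=> mF F0 iF e e0.
have intF : mu.-integrable setT F.
  apply/integrableP; split => //.
  by under eq_integral do rewrite gee0_abs//.
have mf : measurable_fun setT (EFin \o (fine \o F)).
  by apply/measurable_EFinP; apply: measurableT_comp.
have aeF : ae_eq mu setT F (EFin \o (fine \o F)).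
  have := integrable_ae measurableT intF; apply: filterS => x + _ /=.
  by move=> /(_ I) /fineK ->.
have intf : mu.-integrable setT (EFin \o (fine \o F)).
  apply/integrableP; split => //.
  under eq_integral do rewrite gee0_abs ?lee_fin ?fine_ge0//.
  suff <- : \int[mu]_x F x = \int[mu]_x (EFin \o (fine \o F)) x by [].
  exact: ae_eq_integral.
have [r [r0 rP]] := integral_normr_continuous intf e0.
exists r => // E mE /(rP _ mE).
rewrite /Rintegral; under eq_integral do rewrite ger0_norm ?fine_ge0//.
have -> : \int[mu]_(x in E) (fine (F x))%:E = \int[mu]_(x in E) F x.
  apply/esym/ae_eq_integral => //.
  - exact: measurable_funTS.
  - exact: measurable_funTS.
  - by apply: filterS aeF => x h _; exact: h.
rewrite -lte_fin fineK// ge0_fin_numE; last exact: integral_ge0.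
apply: le_lt_trans iF; exact: ge0_subset_integral.
Qed.

Lemma measurable_restrict_fun (E : set T) (F : T -> \bar R) :
  measurable E -> measurable_fun setT F -> measurable_fun setT (F \_ E).
Proof.
move=> mE mF; apply/(measurable_restrictT _ mE); exact: measurable_funTS.
Qed.

Lemma restrict_ge0 (E : set T) (F : T -> \bar R) :
  (forall x, 0 <= F x) -> forall x, 0 <= (F \_ E) x.
Proof. by move=> F0 x; rewrite patchE; case: ifP. Qed.

Lemma ae_nonnull (P : T -> Prop) (C : set T) :
  measurable C -> 0 < mu C -> {ae mu, forall x, P x} -> exists2 x, C x & P x.
Proof.
move=> mC C0 [N [mN N0 PN]]; apply: contrapT => nex.
have CN : C `<=` N.
  by move=> x Cx; apply: PN => Px; apply: nex; exists x.
have : mu C <= 0 by rewrite -N0; apply: le_measure; rewrite ?inE.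
by rewrite leNgt C0.
Qed.

End integrals.

Section classes.
Context d (T : measurableType d) (R : realType) (mu : probability T R).
Implicit Types f g : mp_bijection mu.
Local Open Scope quotient_scope.

Definition aut f : Aut mu := \pi_(Aut mu) f.

Lemma autE f : {ae mu, forall x, aut f x = f x}.
Proof. exact: Aut_piE. Qed.

Lemma aut_repr (S : Aut mu) : aut (repr S) = S.
Proof. exact: reprK. Qed.

Lemma aut_eq f g : {ae mu, forall x, f x = g x} -> aut f = aut g.
Proof.
move=> fg; apply/AutP; move: (autE f) (autE g) fg.
by apply: filterS3 => x -> ->.
Qed.

Lemma eq_aut f g : f =1 g -> aut f = aut g.
Proof. by move=> fg; apply: aut_eq; apply: aeW. Qed.

Lemma aut1 : aut (mp_id mu) = 1%g.
Proof. by []. Qed.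

Lemma autM f g : aut (mp_comp f g) = (aut f * aut g)%g.
Proof.
apply/AutP.
have fgE : {ae mu, forall x, aut f (aut g x) = f (g x)}.
  move: (autE g) (ae_mp_preimage (repr (aut g)) (autE f)).
  by apply: filterS2 => x gE fE; rewrite [LHS]fE -gE.
move: (autE (mp_comp f g)) (Aut_mulE (aut f) (aut g)) fgE.
by apply: filterS3 => x -> -> ->.
Qed.

Lemma autV f : aut (mp_sym f) = (aut f)^-1%g.
Proof.
apply: (mulgI (aut f)); rewrite -autM mulgV -aut1.
by apply: eq_aut => x /=; rewrite mp_invK.
Qed.

End classes.

(** * The L1 full group and its closed subgroups *)

Section L1_group.
Context d (T : measurableType d) (R : realType) (mu : probability T R).
Variable Phi : set (partial_iso mu).
Local Notation D := (word_dist Phi).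
Local Notation dist := (L1_dist Phi).
Local Notation H := (L1_full_group Phi).
Hypothesis mD : measurable_distance Phi.
Implicit Types (S U V : Aut mu) (K : set (Aut mu)).
Local Open Scope ereal_scope.

Lemma measurable_Aut S : measurable_fun setT (S : T -> T).
Proof. exact: measurable_mp_fun. Qed.
Hint Resolve measurable_Aut : core.

Lemma measurable_disp S U : measurable_fun setT (fun x => D (S x) (U x)).
Proof. exact: mD. Qed.
Hint Resolve measurable_disp : core.

Lemma L1_distE S U (f g : T -> T) :
  measurable_fun setT f -> measurable_fun setT g ->
  {ae mu, forall x, S x = f x} -> {ae mu, forall x, U x = g x} ->
  dist S U = \int[mu]_x D (f x) (g x).
Proof.
move=> mf mg Sf Ug; apply: ae_eq_integral => //; first exact: mD.
by apply: filterS2 Sf Ug => x -> -> _.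
Qed.

Lemma L1_dist_aut (f g : mp_bijection mu) :
  dist (aut f) (aut g) = \int[mu]_x D (f x) (g x).
Proof.
by apply: L1_distE; try exact: measurable_mp_fun; exact: autE.
Qed.

Lemma L1_dist_sym S U : dist S U = dist U S.
Proof. by apply: eq_integral => x _; exact: word_dist_sym. Qed.

Lemma L1_distxx S : dist S S = 0.
Proof. by apply: integral0_eq => x _; exact: word_distxx. Qed.

Lemma L1_dist_triangle U S V : dist S V <= dist S U + dist U V.
Proof.
rewrite /L1_dist -ge0_integralD//; try by move=> x _; exact: word_dist_ge0.
apply: ge0_le_integral => //; try by move=> x _; exact: word_dist_ge0.
  exact: emeasurable_funD.
by move=> x _; exact: word_dist_triangle.
Qed.

Lemma L1_distMr V S U : dist (S * V)%g (U * V)%g = dist S U.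
Proof.
rewrite (@L1_distE _ _ (fun x => S (V x)) (fun x => U (V x))).
- by rewrite (integral_mp (repr V) (F := fun x => D (S x) (U x)))//;
    move=> x; exact: word_dist_ge0.
- exact: measurableT_comp.
- exact: measurableT_comp.
- exact: Aut_mulE.
- exact: Aut_mulE.
Qed.

Lemma L1_full_groupE S : H S <-> dist 1%g S < +oo.
Proof.
have -> : dist 1%g S = \int[mu]_x D x (S x).
  by rewrite -{1}[S]aut_repr -aut1 L1_dist_aut.
split=> [[]//|iS]; split => //.
have intS : mu.-integrable setT (fun x => D x (S x)).
  apply/integrableP; split; first exact: mD.
  by under eq_integral do rewrite gee0_abs ?word_dist_ge0//.
have := integrable_ae measurableT intS; apply: filterS => x /(_ I) xS.
by apply: (@word_dist_orbit _ _ _ _ Phi); rewrite -ge0_fin_numE// word_dist_ge0.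
Qed.

Lemma L1_distMV S U : dist 1%g (S * U^-1)%g = dist U S.
Proof. by rewrite -(L1_distMr U) mul1g mulgKV. Qed.

Lemma L1_full_dist S U : H S -> H U -> dist S U < +oo.
Proof.
move=> /L1_full_groupE HS /L1_full_groupE HU.
rewrite (le_lt_trans (L1_dist_triangle 1%g _ _))//.
by rewrite L1_dist_sym lte_add_pinfty.
Qed.

Lemma L1_full_group_closed : group_closed (mem H).
Proof.
split; first by rewrite inE; apply/L1_full_groupE; rewrite L1_distxx.
move=> S U /[!inE] HS HU; apply/L1_full_groupE.
by rewrite L1_distMV; exact: L1_full_dist.
Qed.

Lemma L1_fullM S U : H S -> H U -> H (S * U)%g.
Proof.
move=> HS HU; apply: set_mem.
by apply: group_closedM; rewrite ?inE//; exact: L1_full_group_closed.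
Qed.

Lemma L1_fullV S : H S -> H S^-1%g.
Proof.
move=> HS; apply: set_mem.
by apply: group_closedV; rewrite ?inE//; exact: L1_full_group_closed.
Qed.

Lemma measurable_neq S U : measurable [set x | S x <> U x].
Proof.
rewrite (_ : [set _ | _] = ~` ((fun x => D (S x) (U x)) @^-1` [set 0])).
  by apply: measurableC; rewrite -[_ @^-1` _]setTI; apply: measurable_disp.
apply/seteqP; split => x /= SU => [D0|].
  by have := word_dist_ge1 Phi SU; rewrite D0 lee_fin ler10.
by move=> SU'; apply: SU; rewrite SU' word_distxx.
Qed.

Lemma le_neq_L1_dist S U : mu [set x | S x <> U x] <= dist S U.
Proof.
set E := [set _ | _]; have mE : measurable E by exact: measurable_neq.
have -> : mu E = \int[mu]_(x in E) cst 1 x by rewrite integral_cst// mul1e.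
apply: le_trans (_ : \int[mu]_(x in E) D (S x) (U x) <= _).
  apply: ge0_le_integral => //; first exact: measurable_funTS.
  by move=> x; exact: word_dist_ge1.
by apply: ge0_subset_integral => // x _; exact: word_dist_ge0.
Qed.

(** Right translations are isometries; left translations only displace the
    points where the two elements differ, a set whose measure is controlled by
    their distance, so absolute continuity of the integral applies. *)
Lemma L1_distMl S (e : R) : H S -> (0 < e)%R -> exists2 r : R, (0 < r)%R &
  forall U V, dist U V < r%:E -> dist (S * U)%g (S * V)%g < e%:E.
Proof.
move=> HS e0; pose s x := D x (S x).
have s0 x : 0 <= s x by exact: word_dist_ge0.
have ms : measurable_fun setT s by exact: mD.
have e30 : (0 < e / 3)%R by rewrite divr_gt0.
have [r r0 rP] := integral_small ms s0 HS.2 e30.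
exists (Order.min r (e / 3))%R; first by rewrite lt_min r0.
move=> U V; rewrite EFin_min lt_min => /andP[UVr UVe].
set E := [set x | U x <> V x].
have mE : measurable E by exact: measurable_neq.
have imgE (W : Aut mu) : measurable ((W : T -> T) @` E) /\ mu ((W : T -> T) @` E) < r%:E.
  have [mWE ->] := mp_image_preserving (repr W) mE (@subsetT _ _).
  by split => //; exact: le_lt_trans (le_neq_L1_dist U V) UVr.
have [[mUE UE] [mVE VE]] := (imgE U, imgE V).
rewrite (@L1_distE _ _ (fun x => S (U x)) (fun x => S (V x))); last 4 first.
- exact: measurableT_comp.
- exact: measurableT_comp.
- exact: Aut_mulE.
- exact: Aut_mulE.
pose a (W : Aut mu) x := (s \_ ((W : T -> T) @` E)) (W x).
have ma (W : Aut mu) : measurable_fun setT (a W).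
  apply: (@measurableT_comp _ _ _ _ _ _ (s \_ _) _ W) => //.
  by apply: measurable_restrict_fun => //; exact: (imgE W).1.
have a0 (W : Aut mu) x : 0 <= a W x by exact: restrict_ge0.
apply: (@le_lt_trans _ _ (\int[mu]_x (D (U x) (V x) + (a U x + a V x)))).
  apply: ge0_le_integral => //.
  - by move=> x _; exact: word_dist_ge0.
  - by apply: mD; exact: measurableT_comp.
  - by apply: emeasurable_funD => //; exact: emeasurable_funD.
  - move=> x _; have [Ex|/contrapT ->] := pselect (E x); last first.
      by rewrite !word_distxx adde_ge0// adde_ge0.
    have aE (W : Aut mu) : a W x = s (W x) by rewrite /a patchE mem_set//; exists x.
    rewrite !aE addeCA (le_trans (word_dist_triangle Phi (U x) _ _))//.
    by apply: leeD; [rewrite word_dist_sym|exact: word_dist_triangle].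
rewrite ge0_integralD//; last 3 first.
- by move=> x _; exact: word_dist_ge0.
- by move=> x _; exact: adde_ge0.
- exact: emeasurable_funD.
rewrite ge0_integralD//.
have aE (W : Aut mu) : \int[mu]_x a W x = \int[mu]_(x in (W : T -> T) @` E) s x.
  rewrite (integral_mp (repr W) (F := s \_ ((W : T -> T) @` E))).
  - by rewrite [RHS]integral_mkcond.
  - by apply: measurable_restrict_fun => //; exact: (imgE W).1.
  - exact: restrict_ge0.
rewrite !aE (_ : e = (e / 3 + (e / 3 + e / 3))%R); last by field.
by rewrite !EFinD lteD// lteD// rP.
Qed.

Section closure.

Lemma sub_L1_closure K : K `<=` H -> K `<=` L1_closure Phi K.
Proof.
move=> KH S KS; split; first exact: KH.
by move=> e e0; exists S => //; rewrite L1_distxx.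
Qed.

Lemma L1_closureS K K' : K `<=` K' -> L1_closure Phi K `<=` L1_closure Phi K'.
Proof.
move=> KK' S [HS cS]; split => // e /cS[U KU US]; exists U => //.
exact: KK'.
Qed.

Lemma L1_closureK K : L1_closure Phi (L1_closure Phi K) `<=` L1_closure Phi K.
Proof.
move=> S [HS cS]; split => // e e0.
have e20 : (0 < e / 2)%R by rewrite divr_gt0.
have [U [_ /(_ _ e20)[V KV VU] US]] := cS _ e20.
exists V => //; rewrite (splitr e) EFinD.
by rewrite (le_lt_trans (L1_dist_triangle U _ _))// lteD.
Qed.

Lemma L1_closure_conj K :
  (forall S V, K S -> H V -> K (S ^ V)%g) ->
  forall S V, L1_closure Phi K S -> H V -> L1_closure Phi K (S ^ V)%g.
Proof.
move=> KJ S V [HS cS] HV; split.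
  by apply: L1_fullM; [exact: L1_fullV|exact: L1_fullM].
move=> e e0; have [r r0 rP] := L1_distMl (L1_fullV HV) e0.
have [U KU US] := cS _ r0; exists (U ^ V)%g; first exact: KJ.
by rewrite /conjg; apply: rP; rewrite L1_distMr.
Qed.

(** Inversion needs no estimate beyond the continuity of one translation, as
    the distance from u^-1 to U^-1 is that from U^-1 u to 1. *)
Lemma L1_closure_group_closed K :
  group_closed (mem K) -> K `<=` H -> group_closed (mem (L1_closure Phi K)).
Proof.
move=> gK KH; split.
  by rewrite inE; apply: sub_L1_closure => //; apply: set_mem; case: gK.
move=> S U /[!inE] -[HS cS] [HU cU]; split.
  by apply: L1_fullM => //; exact: L1_fullV.
move=> e e0; have e20 : (0 < e / 2)%R by rewrite divr_gt0.
have [s Ks sS] := cS _ e20.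
have [r r0 rP] := L1_distMl (KH _ Ks) e20.
have [q q0 qP] := L1_distMl (L1_fullV HU) r0.
have [u Ku uU] := cU _ q0.
exists (s * u^-1)%g.
  by apply: set_mem; case: gK => _; apply; exact: mem_set.
rewrite (splitr e) EFinD.
apply: le_lt_trans (L1_dist_triangle (s * U^-1)%g _ _) _.
rewrite lteD ?L1_distMr//; apply: rP.
rewrite L1_dist_sym -(L1_distMr u) mulVg.
by rewrite -(mulVg U); apply: qP; rewrite L1_dist_sym L1_dist_sym.
Qed.

End closure.
End L1_group.

(** * Involutions, markers and shortcuts *)

Section involutions.
Context d (T : measurableType d) (R : realType) (mu : probability T R).
Variable Phi : set (partial_iso mu).
Local Notation D := (word_dist Phi).
Local Notation dist := (L1_dist Phi).
Local Notation H := (L1_full_group Phi).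
Hypothesis mD : measurable_distance Phi.
Implicit Types (S U V : Aut mu) (K : set (Aut mu)) (f g s u v : mp_bijection mu).

Local Open Scope ereal_scope.

Lemma measurable_mp f : measurable_fun setT (f : T -> T).
Proof. exact: measurable_mp_fun. Qed.
Hint Resolve measurable_mp : core.

Definition mp_L1 f : Prop := \int[mu]_x D x (f x) < +oo.

Lemma mp_L1E f : mp_L1 f <-> H (aut f).
Proof. by rewrite L1_full_groupE// -aut1 L1_dist_aut. Qed.

Lemma mp_L1_repr S : H S -> mp_L1 (repr S).
Proof. by rewrite mp_L1E aut_repr. Qed.

Lemma mp_L1_id : mp_L1 (mp_id mu).
Proof.
by apply/mp_L1E; rewrite aut1; apply: set_mem; case: (L1_full_group_closed mD).
Qed.

Lemma mp_L1_comp f g : mp_L1 f -> mp_L1 g -> mp_L1 (mp_comp f g).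
Proof. by rewrite !mp_L1E autM; exact: L1_fullM. Qed.

Lemma mp_L1_le f (F : T -> \bar R) : measurable_fun setT F ->
  (forall x, D x (f x) <= F x) -> \int[mu]_x F x < +oo -> mp_L1 f.
Proof.
move=> mF fF iF; apply: le_lt_trans iF.
apply: ge0_le_integral => //; last exact: mD.
by move=> x _; exact: word_dist_ge0.
Qed.

Lemma mp_L1_comp_disp f g : mp_L1 f -> \int[mu]_x D (g x) (f (g x)) < +oo.
Proof.
move=> L1f; rewrite (integral_mp g (F := fun x => D x (f x)))//; first exact: mD.
by move=> x; exact: word_dist_ge0.
Qed.

(** The identity v (v x) = x is required of a representative at every point,
    which keeps null sets out of the pointwise constructions below. *)
Definition L1_involution : set (Aut mu) :=
  [set S | exists v, [/\ forall x, v (v x) = x, mp_L1 v & S = aut v]].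

Definition involution_group : set (Aut mu) :=
  smallest (fun K : set (Aut mu) => group_closed (mem K)) L1_involution.

Local Notation F := involution_group.

Lemma smallest_group_closed (G : groupType) (X : set G) :
  group_closed (mem (smallest (fun K : set G => group_closed (mem K)) X)).
Proof.
split; first by rewrite inE => K [[K1 _] _]; exact: set_mem.
move=> x y /[!inE] Kx Ky K [gK XK]; apply: set_mem.
by case: (gK) => _; apply; apply: mem_set; [exact: Kx|exact: Ky].
Qed.

Lemma involution_group_closed : group_closed (mem F).
Proof. exact: smallest_group_closed. Qed.

Lemma involution_group_sub : F `<=` H.
Proof.
move=> S; apply; split; first exact: L1_full_group_closed.
by move=> _ [v [_ Lv ->]]; apply/mp_L1E.
Qed.

Lemma involution_in_group v : (forall x, v (v x) = x) -> mp_L1 v -> F (aut v).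
Proof. by move=> vK Lv K [_]; apply; exists v. Qed.

Lemma conjg_group_closed (G : groupType) (X : set G) (z : G) :
  group_closed (mem X) -> group_closed (mem [set x | X (x ^ z)%g]).
Proof.
move=> gX; split; first by rewrite inE /= conj1g; apply: set_mem; case: gX.
move=> x y /[!inE] /= Xx Xy; rewrite conjMg conjVg; apply: set_mem.
by case: gX => _; apply; exact: mem_set.
Qed.

Lemma involution_group_conj S V : F S -> H V -> F (S ^ V)%g.
Proof.
move=> FS HV; apply: (FS [set S | F (S ^ V)%g]); split.
  exact/conjg_group_closed/involution_group_closed.
move=> _ [v [vK Lv ->]] /=; pose g := repr V.
have <- : aut (mp_comp (mp_sym g) (mp_comp v g)) = (aut v ^ V)%g.
  by rewrite !autM autV aut_repr.
apply: involution_in_group; first by move=> x /=; rewrite mp_invK vK mp_funK.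
apply: mp_L1_comp; last by apply: mp_L1_comp => //; exact: mp_L1_repr.
by apply/mp_L1E; rewrite autV aut_repr; exact: L1_fullV.
Qed.

Lemma exists_swap f (C : set T) :
  measurable C -> mp_L1 f -> (forall x, C x -> ~ C (f x)) ->
  exists v, [/\ forall x, v (v x) = x, mp_L1 v, forall x, C x -> v x = f x,
    forall x, C x -> v (f x) = x &
    forall z, ~ C z -> ~ C (mp_inv f z) -> v z = z].
Proof.
move=> mC Lf fC.
have [||||v [v1 v2 v3]] := @swap_mp _ _ _ mu C f mC.
- exact: measurable_funTS.
- exact: image_preservingS (mp_image_preserving f).
- by move=> x y _ _; exact: mp_inj.
- by move=> x y Cx Cy xy; apply: (fC _ Cx); rewrite xy.
have {}v3 z : ~ C z -> ~ C (mp_inv f z) -> v z = z.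
  by move=> Cz Cfz; apply: v3 => // x Cx xz; apply: Cfz; rewrite -xz mp_funK.
have vP z : [\/ C z /\ v z = f z, C (v z) /\ z = f (v z) | v z = z].
  have [Cz|Cz] := pselect (C z); first by constructor 1; split => //; exact: v1.
  have [Cfz|Cfz] := pselect (C (mp_inv f z)); last by constructor 3; exact: v3.
  have vz : v z = mp_inv f z by rewrite -{1}(mp_invK f z) v2.
  by constructor 2; rewrite vz mp_invK.
have vK x : v (v x) = x.
  case: (vP x) => [[Cx ->]|[Cvx xE]|vx]; first exact: v2.
    by rewrite v1.
  by rewrite !vx.
exists v; split => //.
apply: (@mp_L1_le _ (fun x => D x (f x) + D (v x) (f (v x)))).
- by apply: emeasurable_funD; apply: mD => //; exact: measurableT_comp.
- move=> x; case: (vP x) => [[Cx ->]|[Cvx xE]|->].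
  + by rewrite leeDl// word_dist_ge0.
  + by rewrite -xE word_dist_sym leeDr// word_dist_ge0.
  + by rewrite word_distxx adde_ge0// word_dist_ge0.
- rewrite ge0_integralD//; try by move=> x _; exact: word_dist_ge0.
  + by apply: lte_add_pinfty => //; exact: mp_L1_comp_disp.
  + exact: mD.
  + by apply: mD => //; exact: measurableT_comp.
Qed.

Lemma exists_restriction f (E : set T) :
  measurable E -> (forall x, E x <-> E (f x)) -> exists g,
  [/\ forall x, E x -> g x = f x, forall x, ~ E x -> g x = x,
      forall x, D x (g x) <= D x (f x) & mp_L1 f -> mp_L1 g].
Proof.
move=> mE fE.
have restr (h : mp_bijection mu) : (forall x, E x <-> E (h x)) ->
    injective (fun x => if `[< E x >] then h x else x) /\
    image_preserving mu setT (fun x => if `[< E x >] then h x else x).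
  move=> hE.
  have hI : injective (fun x => if `[< E x >] then h x else x).
    move=> x y; case: asboolP => Ex; case: asboolP => Ey.
    - exact: mp_inj.
    - by move=> hxy; exfalso; apply: Ey; rewrite -hxy -hE.
    - by move=> hxy; exfalso; apply: Ex; rewrite hxy -hE.
    - by [].
  split => //.
  apply: (@image_preserving_glue _ _ _ _ _ (bigcup2 E (~` E))) => //.
  - by move=> [|[|k]] //=; exact: measurableC.
  - by rewrite bigcup2E setUv.
  - move=> [|[|k]] B mB /= BE.
    + have -> : [set (if `[< E x >] then h x else x) | x in B] = h @` B.
        by apply: eq_imagel => x /BE Ex; case: asboolP.
      by apply: mp_image_preserving.
    + have -> : [set (if `[< E x >] then h x else x) | x in B] = B => //.
      rewrite -[RHS]image_id; apply: eq_imagel => x /BE Ex.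
      by case: asboolP.
    + have -> : B = set0 by apply/seteqP; split.
      by rewrite image_set0.
have fE' x : E x <-> E (mp_inv f x) by rewrite (fE (mp_inv f x)) mp_invK.
have [fI fp] := restr f fE; have [fI' fp'] := restr (mp_sym f) fE'.
have [||g gE] := mp_of_image_preserving _ _ fp fp'.
- move=> x /=; have [Ex|Ex] := pselect (E x).
    by rewrite (asboolT Ex) (asboolT ((fE x).1 Ex)) mp_funK.
  by rewrite !(asboolF Ex).
- move=> x /=; have [Ex|Ex] := pselect (E x).
    by rewrite (asboolT Ex) (asboolT ((fE' x).1 Ex)) mp_invK.
  by rewrite !(asboolF Ex).
have gf x : D x (g x) <= D x (f x).
  by rewrite gE; case: asboolP => // _; rewrite word_distxx word_dist_ge0.
exists g; split => //.
- by move=> x Ex; rewrite gE; case: asboolP.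
- by move=> x Ex; rewrite gE; case: asboolP.
- by move=> Lf; apply: mp_L1_le Lf => //; exact: mD.
Qed.

(** Greedy construction along the sets B k that separate points: stage k adds
    the points that leave B k, except the neighbours of those already chosen. A
    moved point leaves some B k, so it is chosen unless a neighbour is. *)
Lemma exists_marker (B : (set T)^nat) f : separating B ->
  exists M : set T, [/\ measurable M, forall x, M x -> ~ M (f x) &
    forall x, f x <> x -> [\/ M x, M (f x) | M (mp_inv f x)]].
Proof.
move=> [mB sB].
pose new (A : set T) k := A `|` (B k `&` f @^-1` (~` B k) `&`
  (f @^-1` (~` A) `&` mp_inv f @^-1` (~` A))).
pose A := fix A k := if k is k'.+1 then new (A k') k' else set0.
have pre (h : mp_bijection mu) X : measurable X -> measurable (h @^-1` X).
  exact: measurable_mp_preimage.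
have mA k : measurable (A k).
  elim: k => //= k mAk; apply: measurableU => //.
  by apply: measurableI; apply: measurableI => //; [
    apply: pre|apply: pre|apply: (pre (mp_sym f))]; exact: measurableC.
have Amono k l : (k <= l)%N -> A k `<=` A l.
  elim: l => [|l IH]; first by rewrite leqn0 => /eqP ->.
  rewrite leq_eqVlt => /predU1P[->//|/IH kl]; apply: subset_trans kl _.
  by move=> x ?; left.
have Aind k x : A k x -> ~ A k (f x).
  elim: k x => //= k IH x [Ax|[[Bx Bfx] [Afx _]]] [Afx'|[[Bfx' _] [_ Affx]]].
  - exact: IH Ax Afx'.
  - by move: Affx; rewrite /= mp_funK.
  - by [].
  - by [].
exists (\bigcup_k A k); split; first exact: bigcup_measurable.
  move=> x [k _ Ax] [l _ Afx]; apply: (Aind (maxn k l) x).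
    by apply: Amono Ax; rewrite leq_maxl.
  by apply: Amono Afx; rewrite leq_maxr.
move=> x /nesym fx; have [k [Bx Bfx]] := sB _ _ fx.
have [Afx|Afx] := pselect (A k (f x)); first by constructor 2; exists k.
have [Afx'|Afx'] := pselect (A k (mp_inv f x)); first by constructor 3; exists k.
by constructor 1; exists k.+1 => //; right.
Qed.

(** Precompose with the swap of the points outside A that enter A with their
    images: the image points become fixed, and every excursion into A is
    shortened by one. After n rounds the only points of A still moved are those
    of Z, whose last n images under the inverse lie in A. *)
Lemma exists_shortcut f (A : set T) n : measurable A -> mp_L1 f ->
  let Z := [set x | forall i, (i <= n)%N -> A (iter i (mp_inv f) x)] in
  exists g, [/\ mp_L1 g, F ((aut f)^-1 * aut g)%g,
    forall x, Z x -> g x = f x & forall x, A x -> ~ Z x -> g x = x].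
Proof.
move=> mA Lf /=; elim: n => [|n [g [Lg Fg gZ gA]]].
  exists f; split => //.
    by rewrite mulVg; apply: set_mem; case: involution_group_closed.
  by move=> x Ax nZ; exfalso; apply: nZ => i; rewrite leqn0 => /eqP ->.
pose Z := [set x | forall i, (i <= n)%N -> A (iter i (mp_inv f) x)].
have {}gZ x : Z x -> g x = f x := gZ x.
have {}gA x : A x -> ~ Z x -> g x = x := gA x.
pose C := ~` A `&` g @^-1` A.
have mC : measurable C.
  by apply: measurableI; [exact: measurableC|exact: measurable_mp_preimage].
have [x|v [vK Lv v1 v2 v3]] := exists_swap mC Lg.
  by move=> [_ /= Agx] [].
exists (mp_comp g v); split.
- exact: mp_L1_comp.
- rewrite autM mulgA; apply: set_mem; apply: group_closedM.
  + exact: involution_group_closed.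
  + exact: mem_set.
  + by apply: mem_set; exact: involution_in_group.
- move=> x Zx; have Ax : A x by exact: (Zx 0%N).
  have Zfx : Z (mp_inv f x) by move=> i ni; rewrite -iterSr; exact: Zx.
  have gfx : g (mp_inv f x) = x by rewrite gZ// mp_invK.
  have gx : mp_inv g x = mp_inv f x by rewrite -{1}gfx mp_funK.
  rewrite /= v3.
  + by apply: gZ => i ni; apply: Zx; exact: leqW.
  + by case.
  + by rewrite gx => -[+ _]; apply; exact: (Zfx 0%N).
- move=> x Ax nZx /=.
  have nCx : ~ C x by case.
  have [Zx|nZ] := pselect (Z x); last first.
    have gx := gA x Ax nZ; rewrite v3//.
    by rewrite -{1}gx mp_funK.
  have gK : g (mp_inv g x) = x by rewrite mp_invK.
  suff Cgx : C (mp_inv g x) by rewrite -{1}gK v2// mp_invK.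
  split; last by rewrite /= gK.
  move=> Agx; have [Zg|nZg] := pselect (Z (mp_inv g x)).
    have gx : mp_inv g x = mp_inv f x by rewrite -{2}gK gZ// mp_funK.
    apply: nZx => -[|i] // ni; rewrite iterSr -gx; exact: Zg.
  by have := gA _ Agx nZg; rewrite gK => xg; apply: nZg; rewrite -xg.
Qed.

(** Two rounds of shortcuts are enough, because among three consecutive points
    of a nontrivial orbit one lies in M. *)
Lemma exists_supported_on_marker f (M : set T) :
  measurable M -> mp_L1 f ->
  (forall x, f x <> x -> [\/ M x, M (f x) | M (mp_inv f x)]) ->
  exists g, [/\ mp_L1 g, F ((aut f)^-1 * aut g)%g &
    forall x, ~ M x -> g x = x].
Proof.
move=> mM Lf fM.
have [g [Lg Fg gZ gA]] := exists_shortcut 2 (measurableC mM) Lf.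
exists g; split => // x Mx.
have [Zx|nZx] := pselect (forall i, (i <= 2)%N -> (~` M) (iter i (mp_inv f) x));
  last exact: gA.
rewrite gZ//; apply: contrapT => fx.
have ffx : f (mp_inv f x) <> mp_inv f x.
  by rewrite mp_invK => xf; apply: fx; rewrite {1}xf mp_invK.
case: (fM _ ffx); first exact: (Zx 1%N).
  by rewrite mp_invK; exact: (Zx 0%N).
exact: (Zx 2%N).
Qed.

(** The two orders of composition can only differ at points that one of the
    maps brings to Z, where the displacement of u' is that of u: no control of
    the displacement of u' elsewhere is needed. *)
Lemma commutator_disp s u u' (A Z : set T) :
  measurable Z -> Z `<=` A -> mp_L1 s -> mp_L1 u ->
  (forall x, ~ A x -> s x = x) -> (forall x, Z x -> u' x = u x) ->
  (forall x, A x -> ~ Z x -> u' x = x) ->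
  \int[mu]_x D (s (u' x)) (u' (s x)) <= \int[mu]_(x in Z)
    ((D (u x) (s (u x)) + D x (u x) + (D x (s x) + D (s x) (u (s x)))) +
     (D x (u x) + D x (s x))).
Proof.
move=> mZ ZA Ls Lu sA uZ uA.
have D0 := word_dist_ge0 Phi.
pose p x := D (u x) (s (u x)) + D x (u x) + (D x (s x) + D (s x) (u (s x))).
pose du x := D x (u x); pose ds x := D x (s x).
have mdu : measurable_fun setT du by exact: mD.
have mds : measurable_fun setT ds by exact: mD.
have mp : measurable_fun setT p.
  by apply: emeasurable_funD; apply: emeasurable_funD; apply: mD => //;
    do ?exact: measurableT_comp.
have p0 x : 0 <= p x by rewrite !adde_ge0.
have sAA x : A x -> A (s x).
  move=> Ax; apply: contrapT => nA; apply: (nA).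
  by rewrite (mp_inj (sA _ nA)).
have mr (G : T -> \bar R) : measurable_fun setT G -> measurable_fun setT (G \_ Z).
  exact: measurable_restrict_fun.
have mrc (G : T -> \bar R) h : measurable_fun setT G ->
    measurable_fun setT (fun x => (G \_ Z) ((h : mp_bijection mu) x)).
  move=> mG; exact: (@measurableT_comp _ _ _ _ _ _ (G \_ Z) _ h) (mr G mG) _.
rewrite ge0_integralD//; first last.
- by apply: emeasurable_funD; exact: measurable_funTS.
- by move=> x _; rewrite adde_ge0.
- exact: measurable_funTS.
- by move=> x _; exact: p0.
rewrite [X in _ <= _ + X]ge0_integralD//; first last.
- exact: measurable_funTS.
- exact: measurable_funTS.
have rp y : 0 <= (p \_ Z) y by exact: restrict_ge0.
have ru y : 0 <= (du \_ Z) y by apply: restrict_ge0 => ?; exact: D0.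
have rs y : 0 <= (ds \_ Z) y by apply: restrict_ge0 => ?; exact: D0.
have m1 := mr p mp.
have m2 := mrc du s mdu.
have m3 := mrc ds u' mds.
apply: (@le_trans _ _ (\int[mu]_x ((p \_ Z) x + ((du \_ Z) (s x) + (ds \_ Z) (u' x))))).
  apply: ge0_le_integral => //.
  - by apply: mD; exact: measurableT_comp.
  - by apply: emeasurable_funD => //; exact: emeasurable_funD.
  - move=> x _.
    have rE (G : T -> \bar R) y : Z y -> (G \_ Z) y = G y.
      by move=> Zy; rewrite patchE mem_set.
    have [Zx|nZx] := pselect (Z x).
      apply: (@le_trans _ _ (p x)); last first.
        by rewrite rE// leeDl// adde_ge0.
      rewrite uZ//.
      apply: (le_trans (word_dist_triangle Phi x _ _)); apply: leeD.
        rewrite (le_trans (word_dist_triangle Phi (u x) _ _))//.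
        by rewrite [D (s _) _]word_dist_sym [D (u x) x]word_dist_sym.
      rewrite (le_trans (word_dist_triangle Phi (s x) _ _))// leeD//.
      have [Zsx|nZsx] := pselect (Z (s x)); first by rewrite uZ.
      by rewrite (uA (s x)) ?word_distxx//; exact/sAA/ZA.
    have [Ax|nAx] := pselect (A x).
      rewrite (uA x)//; have [Zsx|nZsx] := pselect (Z (s x)); last first.
        rewrite (uA (s x)) ?word_distxx//; last exact: sAA.
        by rewrite !adde_ge0.
      by rewrite uZ// (rE du)// -/(du (s x)) addeCA leeDl// adde_ge0.
    rewrite (sA x)//; have [Zux|nZux] := pselect (Z (u' x)).
      by rewrite word_dist_sym (rE ds)// addeA leeDr// adde_ge0.
    have nAux : ~ A (u' x).
      by move=> Aux; apply: nAx; rewrite -(mp_inj (uA _ Aux nZux)).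
    by rewrite (sA (u' x))// word_distxx !adde_ge0.
rewrite [X in _ <= X + _]integral_mkcond.
rewrite [X in _ <= _ + (X + _)]integral_mkcond.
rewrite [X in _ <= _ + (_ + X)]integral_mkcond.
rewrite ge0_integralD//; first last.
- exact: emeasurable_funD.
- by move=> x _; rewrite adde_ge0.
rewrite ge0_integralD//.
by rewrite (integral_mp s (mr du mdu) ru) (integral_mp u' (mr ds mds) rs).
Qed.

End involutions.

(** * Commutators are limits of products of involutions *)

Section recurrence.
Context d (T : measurableType d) (R : realType) (mu : probability T R).
Implicit Types (f g : mp_bijection mu) (M : set T).

Lemma iter_mpK f i : cancel (iter i f) (iter i (mp_inv f)).
Proof. by elim: i => // i IH x; rewrite iterSr iterS mp_funK. Qed.

Lemma mp_preserve_iter f i A : measurable A ->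
  measurable (iter i f @^-1` A) /\ mu (iter i f @^-1` A) = mu A.
Proof.
move=> mA; elim: i => [//|i [mi ih]].
rewrite (_ : _ @^-1` _ = f @^-1` (iter i f @^-1` A)); last first.
  by apply/seteqP; split => x; rewrite /= -iterSr.
by rewrite mp_preserve//; split => //; exact: measurable_mp_preimage.
Qed.

(** Poincare recurrence: the points whose whole past lies in M form a set Q
    containing its preimages under the iterates of f; these have the measure of
    Q, so almost every point of Q also has its whole future in Q. *)
Lemma recurrence_null f M : measurable M ->
  mu.-negligible ([set x | forall i, M (iter i (mp_inv f) x)] `&`
                  [set x | exists i, ~ M (iter i f x)]).
Proof.
move=> mM; set Q := [set x | forall i, _]; set K := [set x | exists i, _].
have mQ : measurable Q.
  rewrite (_ : Q = \bigcap_i (iter i (mp_inv f) @^-1` M)).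
    apply: bigcapT_measurable => i.
    by have [] := mp_preserve_iter (mp_sym f) i mM.
  by apply/seteqP; split => x Qx i; [move=> _; exact: Qx|exact: (Qx i I)].
pose E i := Q `\` (iter i f @^-1` Q).
have E0 i : mu (E i) = 0%E.
  have [mi ih] := mp_preserve_iter f i mQ.
  have sub : iter i f @^-1` Q `<=` Q.
    move=> x Qx j; have := Qx (j + i)%N.
    by rewrite iterD iter_mpK.
  rewrite measureD//; last by rewrite ltey_eq fin_num_measure.
  rewrite (setIidr sub); transitivity (mu Q - mu Q)%E.
    by congr (_ - _)%E; exact: ih.
  by rewrite subee// fin_num_measure.
have mE i : measurable (E i).
  by apply: measurableD => //; have [] := mp_preserve_iter f i mQ.
have nE : mu.-negligible (\bigcup_i E i).
  by apply: negligible_bigcup => i; apply/(negligibleP mu (mE i)); exact: E0.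
apply: negligibleS nE => x [Qx [i nM]]; exists i => //; split => // Qi.
by apply: nM; exact: (Qi 0%N).
Qed.

End recurrence.

Section commutators.
Context d (T : measurableType d) (R : realType) (mu : probability T R).
Variable Phi : set (partial_iso mu).
Local Notation D := (word_dist Phi).
Local Notation dist := (L1_dist Phi).
Local Notation H := (L1_full_group Phi).
Hypothesis mD : measurable_distance Phi.
Implicit Types (S U V X Y Z : Aut mu) (f g s u v : mp_bijection mu).
Local Notation F := (involution_group Phi).
Local Notation P := (L1_closure Phi F).
Local Open Scope ereal_scope.
Hint Resolve measurable_mp : core.

Lemma involution_closure_group : group_closed (mem P).
Proof.
apply: L1_closure_group_closed => //; first exact: involution_group_closed.
exact: involution_group_sub.
Qed.

Let PM X Y : P X -> P Y -> P (X * Y)%g.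
Proof.
move=> PX PY; apply: set_mem; apply: (group_closedM involution_closure_group);
  exact: mem_set.
Qed.

Let PV X : P X -> P X^-1%g.
Proof.
move=> PX; apply: set_mem; apply: (group_closedV involution_closure_group).
exact: mem_set.
Qed.

Let PJ X Y : P X -> H Y -> P (X ^ Y)%g.
Proof.
by apply: L1_closure_conj => // S V; exact: involution_group_conj.
Qed.

Let PF : F `<=` P.
Proof. by apply: sub_L1_closure => //; exact: involution_group_sub. Qed.

Definition congr_inv X Y : Prop := P (X^-1 * Y)%g.

Lemma congr_inv_sym X Y : congr_inv X Y -> congr_inv Y X.
Proof. by rewrite /congr_inv => /PV; rewrite invMg invgK. Qed.

Lemma congr_inv_trans X Y Z : congr_inv X Y -> congr_inv Y Z -> congr_inv X Z.
Proof. by move=> XY YZ; have := PM XY YZ; rewrite mulgA mulgK. Qed.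

Lemma congr_invMl Z X Y : congr_inv X Y -> congr_inv (Z * X)%g (Z * Y)%g.
Proof. by rewrite /congr_inv invMg -mulgA mulKg. Qed.

Lemma congr_invMr Z X Y : H Z -> congr_inv X Y -> congr_inv (X * Z)%g (Y * Z)%g.
Proof.
move=> HZ /PJ/(_ HZ); rewrite /congr_inv /conjg invMg.
by rewrite !mulgA.
Qed.

(** By right invariance, S U' and U' S are as close as S U' S^-1 U'^-1 is to 1;
    modulo the closed normal subgroup P this commutator does not depend on the
    choice of U' in its class. *)
Lemma commute_of_almost_commute S U : H S -> H U ->
  (forall e : R, (0 < e)%R -> exists U', [/\ H U', congr_inv U' U &
    dist (S * U')%g (U' * S)%g < e%:E]) ->
  congr_inv (U * S)%g (S * U)%g.
Proof.
move=> HS HU eU.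
suff XP : P (S * U * (U * S)^-1)%g.
  have := PJ XP (L1_fullM mD HU HS).
  by rewrite /congr_inv /conjg mulgKV.
apply: (@L1_closureK _ _ _ _ _ mD); split.
  by apply: L1_fullM => //; [exact: L1_fullM|apply: L1_fullV => //; exact: L1_fullM].
move=> e /eU[U' [HU' U'U dU']].
pose Y := (S * U' * (U' * S)^-1)%g; pose X := (S * U * (U * S)^-1)%g.
exists (Y^-1 * X)%g.
  rewrite -/(congr_inv Y X) /Y /X.
  apply: (@congr_inv_trans _ (S * U * (U' * S)^-1)%g).
    apply: congr_invMr; first by apply: L1_fullV => //; exact: L1_fullM.
    exact: congr_invMl.
  apply: congr_invMl.
  have := PJ (congr_inv_sym U'U) (L1_fullV mD HU).
  by rewrite /congr_inv /conjg !invgK invMg !mulgA mulgK mulgV mul1g.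
rewrite -/X -{2}(mulKVg Y X) -{1}(mul1g (Y^-1 * X)%g) L1_distMr//.
by rewrite /Y L1_distMV// L1_dist_sym.
Qed.

Lemma aut_commute_disjoint s u (A B : set T) :
  (forall x, A x -> ~ B x) -> (forall x, ~ A x -> s x = x) ->
  (forall x, ~ B x -> u x = x) -> (aut s * aut u = aut u * aut s)%g.
Proof.
move=> AB sA uB; rewrite -!autM; apply: eq_aut => x /=.
have [Ax|nAx] := pselect (A x).
  have Asx : A (s x).
    by apply: contrapT => nA; apply: (nA); rewrite (mp_inj (sA _ nA)).
  by rewrite !uB//; exact: AB.
rewrite (sA x)//; apply: sA => Aux; apply: nAx.
by rewrite -(mp_inj (uB _ (AB _ Aux))).
Qed.

(** Shortcutting the excursions of u into M leaves it nontrivial on M only at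
    points outside O whose last n preimages lie in M. Recurrence makes these a
    small set for large n, over which the displacements of the fixed elements s
    and u, the only ones that matter, integrate to little. *)
Lemma almost_commute_outside_invariant s u (M O : set T) (e : R) :
  measurable M -> measurable O -> mp_L1 Phi s -> mp_L1 Phi u ->
  (forall x, ~ M x -> s x = x) -> (forall x, O x -> u x = x) ->
  (forall x, ~ O x -> exists i, ~ M (iter i u x) \/ ~ M (iter i (mp_inv u) x)) ->
  (0 < e)%R ->
  exists U', [/\ H U', congr_inv U' (aut u) &
    dist (aut s * U')%g (U' * aut s)%g < e%:E].
Proof.
move=> mM mO Ls Lu sM uO nO e0.
pose Z n := [set x | forall i, (i <= n)%N -> M (iter i (mp_inv u) x)].
have mZ n : measurable (Z n).
  rewrite (_ : Z n = \bigcap_(i in [set i | (i <= n)%N]) (iter i (mp_inv u) @^-1` M)).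
    apply: bigcap_measurableType => i _.
    by have [] := mp_preserve_iter (mp_sym u) i mM.
  by [].
pose q x := (D (u x) (s (u x)) + D x (u x) + (D x (s x) + D (s x) (u (s x)))) +
     (D x (u x) + D x (s x)).
have mds : measurable_fun setT (fun x => D x (s x)) by exact: mD.
have mdu : measurable_fun setT (fun x => D x (u x)) by exact: mD.
have m1 : measurable_fun setT (fun x => D (u x) (s (u x))).
  by apply: mD => //; exact: measurableT_comp.
have m2 : measurable_fun setT (fun x => D (s x) (u (s x))).
  by apply: mD => //; exact: measurableT_comp.
have D0 := word_dist_ge0 Phi.
have m3 : measurable_fun setT (fun x => D (u x) (s (u x)) + D x (u x)).
  exact: emeasurable_funD.
have m4 : measurable_fun setT (fun x => D x (s x) + D (s x) (u (s x))).
  exact: emeasurable_funD.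
have m5 : measurable_fun setT (fun x => D x (u x) + D x (s x)).
  exact: emeasurable_funD.
have mq : measurable_fun setT q.
  by apply: emeasurable_funD => //; exact: emeasurable_funD.
have q0 x : 0 <= q x by rewrite !adde_ge0.
have iq : \int[mu]_x q x < +oo.
  rewrite /q ge0_integralD//; last 3 first.
  - by move=> x _; rewrite !adde_ge0.
  - exact: emeasurable_funD.
  - by move=> x _; rewrite !adde_ge0.
  apply: lte_add_pinfty; last by rewrite ge0_integralD//; exact: lte_add_pinfty.
  rewrite ge0_integralD//; first last.
  - by move=> x _; rewrite !adde_ge0.
  - by move=> x _; rewrite !adde_ge0.
  apply: lte_add_pinfty; rewrite ge0_integralD//; apply: lte_add_pinfty => //;
    exact: mp_L1_comp_disp.
have [r r0 rP] := integral_small mq q0 iq e0.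
pose ZO n := Z n `\` O.
have mZO n : measurable (ZO n) by exact: measurableD.
have ZO0 : mu (\bigcap_n ZO n) = 0.
  have mI : measurable (\bigcap_n ZO n) by exact: bigcapT_measurable.
  apply/(negligibleP mu mI); apply: negligibleS (recurrence_null u mM) => x Zx.
  split.
    by move=> i; have [h _] := Zx i I; exact: h.
  have [_ Ox] := Zx 0%N I; have [i [|]] := nO _ Ox; first by exists i.
  by move=> []; have [h _] := Zx i I; exact: h.
have : (mu \o ZO) n @[n --> \oo] --> mu (\bigcap_n ZO n).
  apply: nonincreasing_cvg_mu => //.
  - by rewrite ltey_eq fin_num_measure.
  - exact: bigcapT_measurable.
  - move=> m n mn; apply/subsetPset => x [Zx Ox]; split => // i im.
    by apply: Zx; exact: leq_trans mn.
rewrite ZO0 => /fine_cvgP[_ /cvgrPdist_lt /(_ r r0)[n _ /(_ n)]] /=.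
rewrite leqnn sub0r normrN => /(_ isT) nr.
have {nr} ZOr : mu (ZO n) < r%:E.
  rewrite -(@fineK _ (mu (ZO n))) ?fin_num_measure// lte_fin.
  by rewrite (le_lt_trans _ nr)// ler_norm.
have [u' [Lu' Fu' uZ uM]] := exists_shortcut mD n mM Lu.
exists (aut u'); split.
- exact/mp_L1E.
- by apply: congr_inv_sym; exact: PF.
rewrite -!autM L1_dist_aut//=.
apply: le_lt_trans (rP _ (mZO n) ZOr).
apply: (commutator_disp mD (A := M)) => //.
- by move=> x [Zx _]; exact: (Zx 0%N).
- by move=> x [Zx _]; exact: uZ.
- move=> x Mx nZO; have [Zx|nZ] := pselect (Z n x); last exact: uM.
  rewrite uZ// uO//; apply: contrapT => nOx.
  by apply: nZO; split.
Qed.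

(** Modulo involutions, S may be supported on a marker M of S, or on its
    translate S M, which is disjoint from M. Let O be the set of points whose
    whole orbit under U lies in M, and split U along O. The part of U on O
    commutes with the version of S supported on S M; the part off O commutes up
    to small error with the version supported on M. *)
Lemma congr_inv_comm (B : (set T)^nat) S U : separating B -> H S -> H U ->
  congr_inv (U * S)%g (S * U)%g.
Proof.
move=> sB HS HU; pose f := repr S; pose g := repr U.
have fS : aut f = S by exact: aut_repr.
have gU : aut g = U by exact: aut_repr.
have Lf : mp_L1 Phi f by exact: mp_L1_repr.
have Lg : mp_L1 Phi g by exact: mp_L1_repr.
have [M [mM fM Mf]] := exists_marker f sB.
have mM' : measurable (mp_inv f @^-1` M).
  exact: (@measurable_mp_preimage _ _ _ _ (mp_sym f)).
have [s1 [Ls1 Fs1 s1M]] := exists_supported_on_marker mD mM Lf Mf.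
have Mf' x : f x <> x -> [\/ (mp_inv f @^-1` M) x, (mp_inv f @^-1` M) (f x) |
    (mp_inv f @^-1` M) (mp_inv f x)].
  move=> fx; case: (Mf (mp_inv f x)) => /=; first by rewrite mp_invK => xf;
    apply: fx; rewrite {1}xf mp_invK.
  - by constructor 1.
  - by rewrite mp_invK; constructor 2; rewrite /= mp_funK.
  - by constructor 3.
have [s2 [Ls2 Fs2 s2M]] := exists_supported_on_marker mD mM' Lf Mf'.
rewrite fS in Fs1 Fs2.
pose O := [set x | forall i, M (iter i g x) /\ M (iter i (mp_inv g) x)].
have OM : O `<=` M by move=> x Ox; have [] := Ox 0%N.
have mO : measurable O.
  rewrite (_ : O = \bigcap_i ((iter i g @^-1` M) `&` (iter i (mp_inv g) @^-1` M))).
    apply: bigcapT_measurable => i; apply: measurableI.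
      by have [] := mp_preserve_iter g i mM.
    by have [] := mp_preserve_iter (mp_sym g) i mM.
  by apply/seteqP; split => x Ox i; [move=> _; exact: Ox|exact: (Ox i I)].
have gO x : O x <-> O (g x).
  split => Ox i.
    split; first by rewrite -iterSr; have [] := Ox i.+1.
    case: i => [|i]; first by have [] := Ox 1%N.
    by rewrite iterSr mp_funK; have [] := Ox i.
  split; last first.
    by have [_] := Ox i.+1; rewrite iterSr mp_funK.
  case: i => [|i]; last by rewrite iterSr; have [] := Ox i.
  by have [_] := Ox 1%N; rewrite /= mp_funK.
have gO' x : (~` O) x <-> (~` O) (g x) by rewrite /setC /= gO.
have [g1 [g1O g1N _ /(_ Lg) Lg1]] := exists_restriction mD mO gO.
have [g2 [g2N g2O _ /(_ Lg) Lg2]] := exists_restriction mD (measurableC mO) gO'.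
have {}g2O x : O x -> g2 x = x by move=> Ox; apply: g2O; exact.
have UE : U = (aut g1 * aut g2)%g.
  rewrite -gU -autM; apply: eq_aut => x /=; have [Ox|nOx] := pselect (O x).
    by rewrite g2O// g1O.
  by rewrite g2N// g1N//; exact: (gO' x).1.
have it2 x : ~ O x -> forall i, (iter i g2 x = iter i g x /\ ~ O (iter i g x)) /\
    (iter i (mp_inv g2) x = iter i (mp_inv g) x /\ ~ O (iter i (mp_inv g) x)).
  move=> nOx; elim => [//|i [[IH1 IH2] [IH3 IH4]]]; split; split => /=.
  - by rewrite IH1 g2N.
  - by move/(gO _).2.
  - rewrite IH3; set y := iter i _ _.
    rewrite -{1}(mp_invK g y) -(g2N (mp_inv g y)) ?mp_funK//.
    by move/(gO _).1; rewrite mp_invK.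
  - by move/(gO _).1; rewrite mp_invK.
have nO2 x : ~ O x ->
    exists i, ~ M (iter i g2 x) \/ ~ M (iter i (mp_inv g2) x).
  move=> nOx; apply: contrapT => nex; apply: (nOx) => i.
  have [[<- _] [<- _]] := it2 x nOx i.
  by split; apply: contrapT => nM; apply: nex; exists i; [left|right].
have HU1 : H (aut g1) by apply/mp_L1E.
have HU2 : H (aut g2) by apply/mp_L1E.
have Hs1 : H (aut s1) by apply/mp_L1E.
have Hs2 : H (aut s2) by apply/mp_L1E.
(* s2 lives on S M, which misses M and hence O. *)
have c1 : (aut s2 * aut g1 = aut g1 * aut s2)%g.
  apply: (@aut_commute_disjoint _ _ (mp_inv f @^-1` M) O) => //.
  by move=> x /= Mfx /OM; rewrite -{1}(mp_invK f x); exact: fM.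
have c2 : congr_inv (aut g2 * aut s1)%g (aut s1 * aut g2)%g.
  apply: commute_of_almost_commute => // e e0.
  exact: almost_commute_outside_invariant nO2 e0.
have s1S : congr_inv S (aut s1) by exact: PF.
have s2S : congr_inv S (aut s2) by exact: PF.
apply: (@congr_inv_trans _ (aut g1 * aut s1 * aut g2)%g).
  rewrite UE -!mulgA; apply: congr_invMl.
  by apply: congr_inv_trans c2; exact: congr_invMl.
rewrite UE mulgA; apply: congr_invMr => //.
apply: (@congr_inv_trans _ (aut g1 * aut s2)%g).
  apply: congr_invMl; apply: congr_inv_trans s2S; exact: congr_inv_sym.
by rewrite -c1; apply: congr_invMr => //; exact: congr_inv_sym.
Qed.

Lemma derived_sub_involution_closure (B : (set T)^nat) : separating B ->
  L1_closure Phi (derived_subgroup H) `<=` P.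
Proof.
move=> sB X dX; apply: (L1_closureK mD); move: X dX; apply: L1_closureS => S dS.
apply: (dS P); split; first exact: involution_closure_group.
move=> _ [S1 HS1] [S2 HS2] <-.
have := congr_inv_comm sB HS1 HS2.
by rewrite /congr_inv /commg /conjg invMg !mulgA.
Qed.

End commutators.

(** * Alternating groups *)

Section alternating.
Variable I : finType.
Local Open Scope group_scope.

Lemma Alt_sub_of_normal (K : pred {perm I}) : (4 < #|I|)%N ->
  K 1 -> (forall s t, K s -> K t -> K (s * t)) ->
  (forall s t : {perm I}, K s -> ~~ odd_perm t -> K (s ^ t)) ->
  (exists s : {perm I}, [/\ ~~ odd_perm s, s != 1 & K s]) ->
  forall s : {perm I}, ~~ odd_perm s -> K s.
Proof.
move=> I5 K1 KM KJ [s [s_even s1 Ks]] t t_even.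
pose G : {set {perm I}} := finset (fun x => ~~ odd_perm x && K x).
have gG : group_set G.
  apply/group_setP; split; first by rewrite inE odd_perm1.
  move=> x y; rewrite !inE => /andP[/negbTE ox Kx] /andP[/negbTE oy Ky].
  by rewrite odd_permM ox oy KM.
have nG : normal (group gG) 'Alt_I.
  apply/andP; split.
    by apply/fintype.subsetP => x; rewrite inE Alt_even => /andP[].
  apply/fintype.subsetP => y; rewrite Alt_even => oy; rewrite inE.
  apply/fintype.subsetP => _ /imsetP[x + ->].
  by rewrite !inE odd_permJ => /andP[-> Kx]; rewrite KJ.
have /simpleP[_ /(_ _ nG)[G1|GA]] := simple_Alt5 I5.
  have : s \in G by rewrite inE s_even.
  by rewrite [G]G1 inE (negbTE s1).
have : t \in G by rewrite [G]GA Alt_even.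
by rewrite inE => /andP[].
Qed.

Lemma commg_tperm_even (s t : {perm I}) : ~~ odd_perm [~ s, t].
Proof.
by rewrite /commg /conjg !odd_permM !odd_permV; case: odd_perm; case: odd_perm.
Qed.

Lemma commg_tperm (a b c : I) : uniq [:: a; b; c] ->
  let q := [~ tperm a b, tperm b c] in
  [/\ q a = b, q b = c, q c = a &
      forall x, x \notin [:: a; b; c] -> q x = x].
Proof.
rewrite /= !inE negb_or => /and3P[/andP[ab ac] bc _].
have -> : [~ tperm a b, tperm b c] =
    tperm a b * (tperm b c * (tperm a b * tperm b c)).
  by rewrite /commg /conjg !tpermV.
have [ba ca cb] : [/\ b != a, c != a & c != b] by rewrite ![_ == a]eq_sym [c == b]eq_sym.
have abc : tperm a b c = c by rewrite tpermD.
have bca : tperm b c a = a by rewrite tpermD.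
split; first by rewrite !permM tpermL tpermL abc tpermR.
- by rewrite !permM tpermR bca tpermL tpermL.
- by rewrite !permM abc tpermR tpermR bca.
- move=> x; rewrite !inE !negb_or => /and3P[xa xb xc].
  have xab : tperm a b x = x by rewrite tpermD// eq_sym.
  have xbc : tperm b c x = x by rewrite tpermD// eq_sym.
  by rewrite !permM xab xbc xab xbc.
Qed.

(** The commutators of the transpositions (a b) with (b c) and with (b e) are
    3-cycles sharing two points, hence do not commute. *)
Lemma commg_3cycles_neq1 (a b c e : I) : uniq [:: a; b; c; e] ->
  [~ [~ tperm a b, tperm b c], [~ tperm a b, tperm b e]] != 1.
Proof.
rewrite /= !inE !negb_or => /and4P[/and3P[ab ac ae] /andP[bc be] ce _].
have [|q1 q2 q3 _] := @commg_tperm a b c.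
  by rewrite /= !inE negb_or ab ac bc.
have [|r1 r2 r3 rx] := @commg_tperm a b e.
  by rewrite /= !inE negb_or ab ae be.
set q := [~ _, tperm b c] in q1 q2 q3 *.
set r := [~ _, tperm b e] in r1 r2 r3 rx *.
have commE (x y : {perm I}) : [~ x, y] a = y (x (y^-1 (x^-1 a))).
  by rewrite /commg /conjg !permM.
apply/eqP => /(congr1 (fun s : {perm I} => s a)); rewrite perm1 commE.
have -> : q^-1 a = c by apply: (perm_inj (s := q)); rewrite permKV q3.
have rc : r c = c by rewrite rx// !inE !negb_or ![c == _]eq_sym ac bc eq_sym ce.
have -> : r^-1 c = c by apply: (perm_inj (s := r)); rewrite permKV rc.
by rewrite q3 r1 => /eqP; rewrite eq_sym (negbTE ab).
Qed.

End alternating.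

(** * Disjoint copies inside orbits *)

Section copies_in_orbits.
Context d (T : measurableType d) (R : realType) (mu : probability T R).
Variable Phi : set (partial_iso mu).
Local Notation D := (word_dist Phi).
Local Notation H := (L1_full_group Phi).
Variables (B : (set T)^nat) (J : nat -> mp_bijection mu).
Hypothesis sB : separating B.
Hypothesis hJ : generating_involutions Phi J.
Hypothesis aper : aperiodic Phi.
Local Notation gam := (word_mp J).
Implicit Types (f g s u v : mp_bijection mu) (C : set T).
Local Open Scope ereal_scope.

Lemma exists_nonnull C (A : (set T)^nat) : measurable C ->
  (forall k, measurable (A k)) -> 0 < mu C ->
  {ae mu, forall x, C x -> exists k, A k x} ->
  exists k, 0 < mu (C `&` A k).
Proof.
move=> mC mA C0 CA; apply: contrapT => nex.
have nA : mu.-negligible (\bigcup_k (C `&` A k)).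
  apply: negligible_bigcup => k; apply/negligibleP; first exact: measurableI.
  apply/eqP; rewrite eq_le measure_ge0 andbT leNgt; apply/negP => h.
  by apply: nex; exists k.
have : mu.-negligible C.
  apply: negligibleS (negligibleU nA CA) => x Cx.
  have [[k Ak]|nk] := pselect (exists k, A k x); first by left; exists k.
  by right => /(_ Cx).
by move=> /(negligibleP _ mC) C00; rewrite C00 ltxx in C0.
Qed.

Lemma exists_displaced f C : measurable C -> 0 < mu C ->
  {ae mu, forall x, C x -> f x <> x} ->
  exists C', [/\ measurable C', C' `<=` C, 0 < mu C' &
    forall x, C' x -> ~ C' (f x)].
Proof.
move=> mC C0 Cf; have [mB Bxy] := sB.
pose A k := B k `&` f @^-1` (~` B k).
have mA k : measurable (A k).
  by apply: measurableI => //; apply: measurable_mp_preimage; exact: measurableC.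
have [|k k0] := exists_nonnull mC mA C0.
  by apply: filterS Cf => x fx /fx /nesym /Bxy[k [? ?]]; exists k.
exists (C `&` A k); split => //; first exact: measurableI.
by move=> x [_ [_ nB]] [_ [Bf _]].
Qed.

Let enum_word k := gam (odflt [::] (unpickle k)).

Lemma orbit_enum_word x y : orbit_rel Phi x y -> exists k, enum_word k x = y.
Proof.
move=> /(orbit_word hJ)[w ->]; exists (pickle w).
by rewrite /enum_word pickleK.
Qed.

Lemma enum_word_orbit k x : orbit_rel Phi x (enum_word k x).
Proof. by apply/(orbit_word hJ); exists (odflt [::] (unpickle k)). Qed.

(** Let E k be the set of points of C whose k-th word image is not an earlier one.
    The k-th images of the sets E k are disjoint, so their measures are summable,
    while aperiodicity puts almost every point of C in infinitely many E k:
    Borel-Cantelli applies. *)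
Lemma partial_transversal_null C : measurable C ->
  (forall x y, C x -> C y -> orbit_rel Phi x y -> x = y) -> mu C = 0.
Proof.
move=> mC CI; have [mB _] := sB.
pose E k := C `&` [set x | forall j, (j < k)%N -> enum_word j x <> enum_word k x].
have mE k : measurable (E k).
  apply: measurableI => //.
  rewrite (_ : [set _ | _] =
      \bigcap_(j in [set j | (j < k)%N]) ~` [set x | enum_word j x = enum_word k x]) //.
  apply: bigcap_measurableType => j _; apply: measurableC.
  by apply: (measurable_eqset sB); exact: measurable_mp_fun.
have tE : trivIset setT (fun k => enum_word k @` E k).
  move=> k l _ _ [_ [[x [Cx xk] <-] [y [Cy yl] yx]]].
  have xy : x = y.
    apply: CI => //; apply: rst_trans (enum_word_orbit k x) _; rewrite -yx.
    by apply: rst_sym; exact: enum_word_orbit.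
  subst y; case: (ltngtP k l) => // [kl|lk].
    by have := yl _ kl; rewrite yx.
  by have := xk _ lk; rewrite yx.
have mgE k : measurable (enum_word k @` E k).
  by have [] := mp_image_preserving (enum_word k) (mE k) (@subsetT _ _).
have lE : mu (lim_sup_set E) = 0.
  apply: lim_sup_set_cvg0 => //.
  rewrite (eq_eseriesr (g := fun k => mu (enum_word k @` E k))); last first.
    move=> k _.
    by have [_ ->] := mp_image_preserving (enum_word k) (mE k) (@subsetT _ _).
  rewrite -measure_semi_bigcup//; last exact: bigcupT_measurable.
  apply: le_lt_trans (probability_le1 mu _) (ltry _).
  exact: bigcupT_measurable.
have mlE : measurable (lim_sup_set E).
  apply: bigcapT_measurable => n; apply: bigcup_measurable => k _; exact: mE.
apply/(negligibleP mu mC); move/(negligibleP mu mlE) in lE.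
apply: negligibleS (negligibleU lE aper) => x Cx.
have [xinf|] := pselect (infinite_set [set y | orbit_rel Phi x y]); last by right.
left => n _; apply: contrapT => nE; apply: xinf.
apply: (@sub_finite_set _ _ ((fun j => enum_word j x) @` `I_n)); last first.
  exact/finite_image/finite_II.
move=> y /orbit_enum_word ex.
have ex' : exists k, `[< enum_word k x = y >] by have [k ky] := ex; exists k; apply/asboolP.
case: (ex_minnP ex') => k /asboolP ky kmin; exists k => //=.
rewrite ltnNge; apply/negP => nk; apply: nE; exists k => //; split => // j jk jx.
have := kmin j; rewrite leqNgt jk /= => /(_ _)/negP; apply => //.
by apply/asboolP; rewrite jx.
Qed.

(** Otherwise C minus a null set would meet every orbit at most once. *)
Lemma exists_return C : measurable C -> 0 < mu C ->
  exists w C', [/\ measurable C', C' `<=` C, 0 < mu C' &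
    forall x, C' x -> C (gam w x) /\ ~ C' (gam w x)].
Proof.
move=> mC C0; pose A k := enum_word k @^-1` C `&` ~` [set x | enum_word k x = x].
have mA k : measurable (A k).
  apply: measurableI; first exact: measurable_mp_preimage.
  by apply: measurableC; apply: (measurable_eqset sB) => //; exact: measurable_mp_fun.
have [[k k0]|nk] := pselect (exists k, 0 < mu (C `&` A k)).
  have [||C' [mC' C'C C'0 C'g]] := @exists_displaced (enum_word k) (C `&` A k) _ k0.
  - exact: measurableI.
  - by apply: aeW => x [_ []].
  exists (odflt [::] (unpickle k)), C'; split => //.
    by move=> x /C'C[].
  by move=> x C'x; split; [have [_ []] := C'C _ C'x|exact: C'g].
exfalso; have nA k : mu (C `&` A k) = 0.
  apply/eqP; rewrite eq_le measure_ge0 andbT leNgt; apply/negP => h.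
  by apply: nk; exists k.
pose C1 := C `\` \bigcup_k (C `&` A k).
have mC1 : measurable C1.
  by apply: measurableD => //; apply: bigcupT_measurable => k; exact: measurableI.
have nC1 : mu.-negligible C1.
  apply/(negligibleP mu mC1); apply: partial_transversal_null => //.
  move=> x y [Cx nx] [Cy _] /orbit_enum_word[k xy].
  apply: contrapT => nxy; apply: nx; exists k => //; split => //.
  by split; rewrite /= xy// => yx; apply: nxy.
have : mu.-negligible C.
  apply: (@negligibleS _ _ _ _ (C1 `|` \bigcup_k (C `&` A k))).
    move=> x Cx; have [|?] := pselect ((\bigcup_k (C `&` A k)) x); first by right.
    by left.
  apply: negligibleU => //; apply: negligible_bigcup => k.
  apply/(negligibleP mu); [exact: measurableI|exact: nA].
by move=> /(negligibleP mu mC) C00; rewrite C00 ltxx in C0.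
Qed.

Hypothesis mD : measurable_distance Phi.

Lemma mp_L1_word w : mp_L1 Phi (gam w).
Proof.
apply: (@mp_L1_le _ _ _ _ _ mD _ (cst ((size w)%:R%:E))) => //.
  by move=> x; exact: (word_dist_word hJ).
rewrite integral_cst//; apply: lte_mul_pinfty => //.
exact: le_lt_trans (probability_le1 mu measurableT) (ltry _).
Qed.

Lemma mp_copies (I : finType) C (h : I -> mp_bijection mu) : measurable C ->
  (forall i j x y, C x -> C y -> h i x = h j y -> i = j) ->
  copies mu C h.
Proof.
move=> mC hI; split => //.
- by move=> i; apply: measurable_funTS; exact: measurable_mp_fun.
- by move=> i; exact: image_preservingS (mp_image_preserving (h i)).
- move=> i j x y Cx Cy hxy; have ij := hI _ _ _ _ Cx Cy hxy.
  by split => //; move: hxy; rewrite ij; exact: mp_inj.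
Qed.

(** A point of the copy i is joined to its image in the copy j through the point
    of C below both, at the cost of the displacements of h i and h j. *)
Lemma permute_L1 (I : finType) C (h : I -> mp_bijection mu) (s : {perm I}) f :
  copies mu C h -> (forall i, mp_L1 Phi (h i)) ->
  mp_fun f = permute_copies C h s -> mp_L1 Phi f.
Proof.
move=> hC Lh fE.
pose F (p : I * I) x :=
  D (mp_inv (h p.1) x) (h p.1 (mp_inv (h p.1) x)) +
  D (mp_inv (h p.1) x) (h p.2 (mp_inv (h p.1) x)).
have m1 i j : measurable_fun setT (fun x => D (mp_inv (h i) x) (h j (mp_inv (h i) x))).
  apply: mD; first exact: measurable_mp_inv.
  by apply: measurableT_comp; [exact: measurable_mp_fun|exact: measurable_mp_inv].
have mF p : measurable_fun setT (F p) by exact: emeasurable_funD.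
have F0 p x : 0 <= F p x by rewrite adde_ge0// word_dist_ge0.
apply: (@mp_L1_le _ _ _ _ _ mD _ (fun x => \sum_(p : I * I) F p x)).
- exact: emeasurable_sum.
- move=> x; rewrite fE.
  have [[y Cy [i <-]]|xC] := permute_copiesP C (fun i => h i : T -> T) x; last first.
    rewrite permute_copies_out// word_distxx; apply: sume_ge0 => p _; exact: F0.
  rewrite (permute_copiesE hC)// (bigD1 (i, s i))//= -[leLHS]adde0.
  apply: leeD; last by apply: sume_ge0 => p _; exact: F0.
  rewrite /F /= mp_funK [D y (h i y)]word_dist_sym; exact: word_dist_triangle.
- rewrite ge0_integral_sum//; apply: lte_sum_pinfty => p _.
  rewrite ge0_integralD//; try by move=> x _; exact: word_dist_ge0.
  by apply: lte_add_pinfty;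
    rewrite (mp_L1_comp_disp mD (mp_sym (h p.1)) (Lh _)).
Qed.

(** A return inside C1 doubles every copy of C1 at once, so that the number of
    disjoint copies grows by composing maps rather than by separating them
    again. *)
Lemma prod_copies (K : finType) (k : K -> mp_bijection mu) C1 C2 (a : mp_bijection mu) :
  measurable C2 -> C2 `<=` C1 ->
  (forall p q x y, C1 x -> C1 y -> k p x = k q y -> p = q) ->
  (forall x, C2 x -> C1 (a x) /\ ~ C2 (a x)) ->
  copies mu C2 (fun i : K * bool =>
    if i.2 then mp_comp (k i.1) a else k i.1 : mp_bijection mu).
Proof.
move=> mC2 C21 kI aC.
have aC1 (b : bool) x : C2 x -> C1 ((if b then a x else x)).
  by case: b => Cx; [have [] := aC _ Cx|exact: C21].
have hE i x : (if i.2 then mp_comp (k i.1) a else k i.1 : mp_bijection mu) x =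
    k i.1 (if i.2 then a x else x) by case: i => p [].
apply: mp_copies => // -[p b] [q c] x y Cx Cy; rewrite !hE /= => h.
have pq := kI _ _ _ _ (aC1 b _ Cx) (aC1 c _ Cy) h; subst q.
move/mp_inj : h; case: b; case: c => // h.
  by have [_] := aC _ Cx; rewrite h.
by have [_] := aC _ Cy; rewrite -h.
Qed.

End copies_in_orbits.

(** * Small involutions in a normal subgroup *)

Section derived.
Context d (T : measurableType d) (R : realType) (mu : probability T R).
Variable Phi : set (partial_iso mu).
Local Notation D := (word_dist Phi).
Local Notation H := (L1_full_group Phi).
Hypothesis mD : measurable_distance Phi.

Lemma derived_subgroup_sub : derived_subgroup H `<=` H.
Proof.
move=> S dS; apply: (dS H); split; first exact: L1_full_group_closed.
move=> _ [x Hx] [y Hy] <-.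
by do ?[exact: L1_fullV|apply: L1_fullM => //].
Qed.

Lemma derived_subgroup_comm x y : H x -> H y -> derived_subgroup H [~ x, y]%g.
Proof. by move=> Hx Hy K [_]; apply; exists x => //; exists y. Qed.

Lemma derived_subgroup_conj x y :
  derived_subgroup H x -> H y -> derived_subgroup H (x ^ y)%g.
Proof.
move=> dx Hy; apply: (dx [set x | derived_subgroup H (x ^ y)%g]); split.
  exact/conjg_group_closed/smallest_group_closed.
move=> _ [a Ha] [b Hb] <- /=; rewrite conjRg.
by apply: derived_subgroup_comm; rewrite /conjg;
  do ?[exact: L1_fullV|apply: L1_fullM => //].
Qed.

Section representation.
Variables (I : finType) (C : set T) (h : I -> mp_bijection mu).
Hypotheses (hC : copies mu C h) (Lh : forall i, mp_L1 Phi (h i)).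
Variable r : {perm I} -> mp_bijection mu.
Hypothesis rE : forall s, mp_fun (r s) = permute_copies C h s^-1%g.
Local Notation rho s := (aut (r s)).

Lemma repM s t : rho (s * t)%g = (rho s * rho t)%g.
Proof.
rewrite -autM; apply: eq_aut => x /=.
by rewrite !rE invMg (permute_copiesM hC).
Qed.

Lemma rep1 : rho 1%g = 1%g.
Proof. by apply: (mulgI (rho 1%g)); rewrite -repM !mulg1. Qed.

Lemma repV s : rho s^-1%g = (rho s)^-1%g.
Proof. by apply: (mulgI (rho s)); rewrite -repM !mulgV rep1. Qed.

Lemma repJ s t : rho (s ^ t)%g = (rho s ^ rho t)%g.
Proof. by rewrite /conjg !repM repV. Qed.

Lemma repR s t : rho [~ s, t]%g = [~ rho s, rho t]%g.
Proof. by rewrite /commg /conjg !repM !repV. Qed.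

Lemma rep_L1 s : H (rho s).
Proof. by apply/mp_L1E => //; exact: (permute_L1 mD (s := s^-1%g) hC). Qed.

(** The even permutations represented in the derived subgroup form a normal
    subgroup of the alternating group, which is simple; it contains a 3-cycle,
    a commutator of two transpositions. *)
Lemma rep_derived (a b c : I) s : (4 < #|I|)%N -> uniq [:: a; b; c] ->
  ~~ odd_perm s -> derived_subgroup H (rho s).
Proof.
move=> I5 abc s_even.
have gD : group_closed (mem (derived_subgroup H)) by exact: smallest_group_closed.
apply/asboolP; move: s s_even.
apply: (@Alt_sub_of_normal I (fun s => `[< derived_subgroup H (rho s) >])) => //.
- by apply/asboolP; rewrite rep1; apply: set_mem; case: gD.
- move=> s t /asboolP Ds /asboolP Dt; apply/asboolP; rewrite repM.
  by apply: set_mem; apply: group_closedM => //; exact: mem_set.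
- move=> s t /asboolP Ds _; apply/asboolP; rewrite repJ.
  by apply: derived_subgroup_conj => //; exact: rep_L1.
exists [~ tperm a b, tperm b c]%g; split.
- exact: commg_tperm_even.
- have [qa _ _ _] := commg_tperm abc; apply/eqP => q1.
  move: qa; rewrite q1 perm1 => ab; move: abc.
  by rewrite ab /= inE eqxx.
- by apply/asboolP; rewrite repR; apply: derived_subgroup_comm; exact: rep_L1.
Qed.

End representation.

Section normal.
Variables (B : (set T)^nat) (J : nat -> mp_bijection mu).
Hypothesis sB : separating B.
Hypothesis hJ : generating_involutions Phi J.
Hypothesis aper : aperiodic Phi.
Local Notation gam := (word_mp J).
Local Notation G := (L1_closure Phi (derived_subgroup H)).
Variable N : set (Aut mu).
Hypothesis nN : normal_subgroup_of N G.
Implicit Types (S U V : Aut mu) (f g v : mp_bijection mu) (C : set T).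

Lemma derived_sub_closure : derived_subgroup H `<=` G.
Proof. by apply: sub_L1_closure => //; exact: derived_subgroup_sub. Qed.

Lemma normal_M x y : N x -> N y -> N (x * y)%g.
Proof.
by move=> Nx Ny; apply: set_mem; have [gN _ _] := nN;
  apply: group_closedM => //; exact: mem_set.
Qed.

Lemma normal_V x : N x -> N x^-1%g.
Proof.
by move=> Nx; apply: set_mem; have [gN _ _] := nN;
  apply: group_closedV => //; exact: mem_set.
Qed.

Lemma normal_1 : N 1%g.
Proof. by have [[N1 _] _ _] := nN; exact: set_mem. Qed.

Lemma normal_J x y : N x -> G y -> N (x ^ y)%g.
Proof. by have [_ _] := nN; apply. Qed.

(** If S displaces C, then conjugation by S moves an element supported on C off
    C, so the double commutator of S, U, V is the commutator of U and V. *)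
Lemma comm_in_normal S (u v : mp_bijection mu) C : N S ->
  (forall x, C x -> ~ C (S x)) ->
  (forall x, ~ C x -> u x = x) -> (forall x, ~ C x -> v x = x) ->
  G (aut u) -> G (aut v) -> N [~ aut u, aut v]%g.
Proof.
move=> NS SC uC vC Gu Gv; pose f := repr S.
set U := aut u; set V := aut v.
pose W := ((U^-1) ^ S)%g.
have WV : (W * V = V * W)%g.
  have -> : W = aut (mp_comp (mp_sym f) (mp_comp (mp_sym u) f)).
    by rewrite !autM !autV aut_repr.
  apply: (@aut_commute_disjoint _ _ _ _ _ _ [set x | C (f x)] C) => //.
    by move=> x /= Cfx Cx; exact: (SC x).
  move=> x /= nC; rewrite -[in X in mp_inv u X](uC _ nC) mp_funK mp_funK.
  by [].
have N1 : N (W * U)%g.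
  have -> : (W * U = S^-1 * (S ^ U))%g by rewrite /W /conjg !mulgA.
  by apply: normal_M; [exact: normal_V|exact: normal_J].
have -> : [~ U, V]%g = ((W * U)^-1 * (W * U) ^ V)%g.
  have WVE : (W ^ V = W)%g by rewrite /conjg WV mulKg.
  by rewrite conjMg WVE invMg /commg -[RHS]mulgA mulKg.
by apply: normal_M; [exact: normal_V|exact: normal_J].
Qed.

(** Inside C choose four disjoint copies of a small set, and add the images of
    two of them under v. The alternating group on these six copies acts through
    the derived subgroup, and meets N nontrivially by the double commutator
    trick applied to two 3-cycles moving only the four copies inside C. As it
    is simple, N contains the exchange of two copies with their images. *)
Lemma small_swap_in_normal S v C : N S -> mp_L1 Phi v ->
  (forall x, v (v x) = x) -> measurable C -> (0 < mu C)%E ->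
  (forall x, C x -> ~ C (S x)) -> (forall x, C x -> ~ C (v x)) ->
  exists E g, [/\ measurable E, (0 < mu E)%E, forall x, E x -> C x \/ C (v x),
    forall x, E x -> E (v x) &
    [/\ N (aut g), forall x, E x -> g x = v x & forall x, ~ E x -> g x = x]].
Proof.
move=> NS Lv vK mC C0 SC vC.
have [w1 [C1 [mC1 C1C C10 C1g]]] := exists_return sB hJ aper mC C0.
have [w2 [C2 [mC2 C21 C20 C2a]]] := exists_return sB hJ aper mC1 C10.
set b1 := gam w1 in C1g; set a := gam w2 in C2a.
(* The copies are indexed by [option bool * bool]: the first component chooses
   between the image under v, C1 itself, and its return under b1; the second
   between C2 and its return under a. *)
pose k (p : option bool) : mp_bijection mu :=
  if p is Some e then if e then b1 else mp_id mu else v.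
have kI p q x y : C1 x -> C1 y -> k p x = k q y -> p = q.
  move=> Cx Cy; have [b1x nb1x] := C1g _ Cx; have [b1y nb1y] := C1g _ Cy.
  have [vx vy] := (vC _ (C1C _ Cx), vC _ (C1C _ Cy)).
  have [Cx' Cy'] := (C1C _ Cx, C1C _ Cy).
  case: p => [[]|]; case: q => [[]|] //= E; exfalso.
  - by apply: nb1x; rewrite E.
  - by apply: vy; rewrite -E.
  - by apply: nb1y; rewrite -E.
  - by apply: vy; rewrite -E.
  - by apply: vx; rewrite E.
  - by apply: vx; rewrite E.
pose h (i : option bool * bool) : mp_bijection mu :=
  if i.2 then mp_comp (k i.1) a else k i.1.
have hC : copies mu C2 h := prod_copies mC2 C21 kI C2a.
have hE i x : h i x = k i.1 (if i.2 then a x else x).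
  by rewrite /h; case: i => p [].
have aC b x : C2 x -> C1 (if b then a x else x).
  by case: b => Cx; [have [] := C2a _ Cx|exact: C21].
have Lh i : mp_L1 Phi (h i).
  have Lk p : mp_L1 Phi (k p).
    case: p => [[]|] //=; [exact: mp_L1_word|exact: mp_L1_id].
  rewrite /h; case: (i.2) => //; apply: mp_L1_comp => //; exact: mp_L1_word.
have [r rE] := permute_copies_mp hC.
have hCk p b x : C2 x -> C (h (Some p, b) x).
  move=> Cx; rewrite hE /=; have := aC b _ Cx; case: p => //= C1x.
    by have [] := C1g _ C1x.
  exact: C1C.
have I5 : (4 < #|{: option bool * bool}|)%N.
  by rewrite card_prod card_option card_bool.
pose l (p b : bool) : option bool * bool := (Some p, b).
have rC p q s x : uniq [:: l false false; l false true; l p q] ->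
    s = [~ tperm (l false false) (l false true), tperm (l false true) (l p q)]%g ->
    ~ C x -> r s x = x.
  move=> u3 sE nCx; rewrite rE.
  have [[y Cy [[[e|] b] hy]]|out] := permute_copiesP C2 (fun i => h i : T -> T) x.
  - by exfalso; apply: nCx; rewrite -hy; exact: hCk.
  - rewrite -hy (permute_copiesE hC)//; congr (h _ y).
    have [_ _ _ fix_s] := commg_tperm u3.
    by apply: (perm_inj (s := s)); rewrite permKV sE fix_s.
  - exact: permute_copies_out.
have Gr s : ~~ odd_perm s -> G (aut (r s)).
  move=> s_even; apply: derived_sub_closure.
  exact: (rep_derived hC Lh rE (a := l false false) (b := l false true)
    (c := l true false)).
have NAlt s : ~~ odd_perm s -> N (aut (r s)).
  move=> s_even; apply/asboolP; move: s s_even.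
  apply: (@Alt_sub_of_normal _ (fun s => `[< N (aut (r s)) >])) => //.
  - by apply/asboolP; rewrite (rep1 hC rE); exact: normal_1.
  - move=> s t /asboolP Ns /asboolP Nt; apply/asboolP.
    by rewrite (repM hC rE); exact: normal_M.
  - move=> s t /asboolP Ns /Gr Gt; apply/asboolP.
    by rewrite (repJ hC rE); exact: normal_J.
  pose s1 := [~ tperm (l false false) (l false true),
                tperm (l false true) (l true false)]%g.
  pose s2 := [~ tperm (l false false) (l false true),
                tperm (l false true) (l true true)]%g.
  exists [~ s1, s2]%g; split.
  - exact: commg_tperm_even.
  - exact: commg_3cycles_neq1.
  - apply/asboolP; rewrite (repR hC rE); apply: (comm_in_normal NS SC).
    + by move=> x; exact: (rC true false).
    + by move=> x; exact: (rC true true).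
    + by apply: Gr; exact: commg_tperm_even.
    + by apply: Gr; exact: commg_tperm_even.
pose n b : option bool * bool := (None, b).
pose t := (tperm (l false true) (n true) * tperm (l false false) (n false))%g.
have tE : t^-1%g = (tperm (l false false) (n false) * tperm (l false true) (n true))%g.
  by rewrite invMg !tpermV.
have tl b : t^-1%g (l false b) = n b.
  by rewrite tE permM; case: b;
    rewrite ?tpermL ?[tperm (l false false) _ _]tpermD ?tpermL ?tpermD.
have tn b : t^-1%g (n b) = l false b.
  by rewrite tE permM; case: b;
    rewrite ?tpermR ?[tperm (l false false) _ _]tpermD ?tpermR ?tpermD.
have tt b : t^-1%g (l true b) = l true b.
  by rewrite tE permM !tpermD.
have hn b x : h (n b) x = v (h (l false b) x) by rewrite !hE.
pose E := \bigcup_(b in [set: bool]) (h (l false b) @` C2 `|` h (n b) @` C2).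
have lE b x : C2 x -> E (h (l false b) x) by move=> Cx; exists b => //; left; exists x.
have nE b x : C2 x -> E (h (n b) x) by move=> Cx; exists b => //; right; exists x.
have mE : measurable E.
  apply: fin_bigcup_measurable; first exact: finite_finset.
  by move=> b _; apply: measurableU; exact: (measurable_copy hC).
exists E, (r t); split => //.
- apply: lt_le_trans C20 _; apply: le_measure; rewrite ?inE// => x Cx.
  by have := lE false x Cx; rewrite hE.
- move=> _ [b _ [[x Cx <-]|[x Cx <-]]]; first by left; exact: hCk.
  by right; rewrite hn vK; exact: hCk.
- move=> _ [b _ [[x Cx <-]|[x Cx <-]]]; first by rewrite -hn; exact: nE.
  by rewrite hn vK; exact: lE.
split.
- by apply: NAlt; rewrite odd_permM !odd_tperm.
- move=> _ [b _ [[x Cx <-]|[x Cx <-]]]; rewrite rE (permute_copiesE hC)//.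
    by rewrite tl hn.
  by rewrite tn hn vK.
- move=> x nEx; rewrite rE.
  have [[y Cy [[[[]|] b] hy]]|out] := permute_copiesP C2 (fun i => h i : T -> T) x.
  - by rewrite -hy (permute_copiesE hC)// [X in h X]tt.
  - by exfalso; apply: nEx; rewrite -hy; exact: lE.
  - by exfalso; apply: nEx; rewrite -hy; exact: nE.
  - exact: permute_copies_out.
Qed.

End normal.
End derived.

(** * The support of a normal subgroup *)

Section maximal.
Context d (T : measurableType d) (R : realType) (mu : probability T R).
Local Open Scope ereal_scope.

(** Greedy choice along a sequence replaces a transfinite exhaustion, since the
    measure is finite. *)
Lemma exists_maximal_measure (E : set (set T)) (E0 : set T) :
  (forall A, E A -> measurable A) -> E E0 ->
  (forall F : (set T)^nat, (forall n, E (F n)) ->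
    (forall n, F n `<=` F n.+1) -> E (\bigcup_n F n)) ->
  exists2 A, E A & forall G, E G -> A `<=` G -> mu G <= mu A.
Proof.
move=> mE EE0 EU.
have step (n : nat) (A : {A | E A}) : exists A' : {A | E A}, sval A `<=` sval A' /\
    forall G, E G -> sval A `<=` G -> mu G <= mu (sval A') + (n.+1%:R^-1)%:E.
  case: A => A EA /=; pose X := [set mu G | G in [set G | E G /\ A `<=` G]].
  have X0 : X (mu A) by exists A => //; split.
  have supX : ereal_sup X \is a fin_num.
    rewrite fin_real// (lt_le_trans _ (ereal_sup_ubound X0))/=; last first.
      by rewrite (lt_le_trans _ (measure_ge0 _ _)).
    apply: (@le_lt_trans _ _ 1); last exact: ltry.
    by apply: ge_ereal_sup => _ [G [EG _] <-]; exact/probability_le1/mE.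
  have n0 : (0 < n.+1%:R^-1 :> R)%R by rewrite invr_gt0.
  have [_ [G [EG AG] <-] Gsup] := ub_ereal_sup_adherent n0 supX.
  exists (exist _ G EG); split => //= G' EG' AG'.
  apply: (@le_trans _ _ (ereal_sup X)); first by apply: ereal_sup_ubound; exists G'.
  by rewrite -leeBlDr//; exact: ltW.
have /choice[nxt nxtP] : forall p : nat * {A | E A}, exists A' : {A | E A},
    sval p.2 `<=` sval A' /\ forall G, E G -> sval p.2 `<=` G ->
      mu G <= mu (sval A') + (p.1.+1%:R^-1)%:E.
  by move=> [n A]; exact: step.
pose F := fix F n := if n is m.+1 then nxt (m, F m) else exist _ E0 EE0.
have Fmono n : sval (F n) `<=` sval (F n.+1) by have [] := nxtP (n, F n).
exists (\bigcup_n sval (F n)); first by apply: EU => // n; exact: (svalP (F n)).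
have mF n : measurable (sval (F n)) by exact/mE/(svalP (F n)).
move=> G EG FG; apply/lee_addgt0Pr => e e0.
pose n := Num.truncn e^-1.
have ne : (n.+1%:R^-1 <= e :> R)%R.
  rewrite -[leRHS]invrK lef_pV2 ?posrE ?invr_gt0//; apply/ltW.
  exact: truncnS_gt.
have [_ /(_ G EG)] := nxtP (n, F n) => /=.
move=> /(_ (subset_trans (@bigcup_sup _ _ n _ _ I) FG)) h.
apply: le_trans h _; apply: leeD; last by rewrite lee_fin.
apply: le_measure; rewrite ?inE//; first exact: mF n.+1.
  exact: bigcupT_measurable.
exact: (@bigcup_sup _ _ n.+1 setT (fun n => sval (F n))).
Qed.

End maximal.

Section normal_subgroups.
Context d (T : measurableType d) (R : realType) (mu : probability T R).
Variable Phi : set (partial_iso mu).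
Local Notation D := (word_dist Phi).
Local Notation dist := (L1_dist Phi).
Local Notation H := (L1_full_group Phi).
Local Notation G := (L1_closure Phi (derived_subgroup H)).
Variables (B : (set T)^nat) (J : nat -> mp_bijection mu).
Hypothesis sB : separating B.
Hypothesis hJ : generating_involutions Phi J.
Hypothesis aper : aperiodic Phi.
Hypothesis mD : measurable_distance Phi.
Variable N : set (Aut mu).
Hypothesis nN : normal_subgroup_of N G.
Hypothesis cN : L1_closed_in Phi N G.
Local Notation gam := (word_mp J).
Implicit Types (S U V : Aut mu) (f g v : mp_bijection mu) (C : set T).

Hint Resolve measurable_mp measurable_Aut : core.

Lemma normal_sub : N `<=` G. Proof. by have [] := nN. Qed.

Lemma normal_closed S : L1_closure Phi N S -> N S.
Proof.
move=> clS; apply: cN; split => //; apply: (L1_closureK mD).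
exact: L1_closureS normal_sub _ clS.
Qed.

Lemma measurable_supp S : measurable (supp S).
Proof.
have mSx : measurable [set x | S x = x] by apply: (measurable_eqset sB).
rewrite (_ : supp S = ~` [set x | S x = x]); first exact: measurableC.
by apply/seteqP; split.
Qed.

Lemma negligible_setD (X Y : set T) : measurable X -> measurable Y ->
  (mu (X `|` Y) <= mu X)%E -> mu.-negligible (Y `\` X).
Proof.
move=> mX mY XY; apply/(negligibleP mu); first exact: measurableD.
have -> : Y `\` X = (X `|` Y) `\` X by rewrite setDUl setDv set0U.
have mXY : measurable (X `|` Y) by exact: measurableU.
apply/eqP; rewrite eq_le measure_ge0 andbT measureD//; last first.
  by rewrite ltey_eq fin_num_measure.
by rewrite setUK leeBlDr ?fin_num_measure// add0e.
Qed.

(** A countable union of supports whose measure cannot be increased absorbs, up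
    to a null set, the support of every element of N. *)
Lemma exists_ess_support : exists A0 : set T,
  [/\ exists S_ : nat -> Aut mu, (forall n, N (S_ n)) /\ A0 = \bigcup_n supp (S_ n),
      measurable A0 & forall S, N S -> {ae mu, forall x, supp S x -> A0 x}].
Proof.
pose E := [set A : set T | exists S_ : nat -> Aut mu,
  (forall n, N (S_ n)) /\ A = \bigcup_n supp (S_ n)].
have mE A : E A -> measurable A.
  by move=> [S_ [_ ->]]; apply: bigcupT_measurable => n; exact: measurable_supp.
have [|F EF _|A EA Amax] := @exists_maximal_measure _ _ _ mu E
  (\bigcup_(n : nat) supp (1%g : Aut mu)) mE.
- by exists (fun=> 1%g); split => // _; exact: (normal_1 nN).
- have /choice[S_ S_P] : forall n, exists S_ : nat -> Aut mu,
      (forall k, N (S_ k)) /\ F n = \bigcup_k supp (S_ k) by exact: EF.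
  exists (fun k => if unpickle k is Some (m, n) then S_ m n else S_ 0%N 0%N); split.
    move=> k; case: (unpickle k) => [[m n]|].
      by have [NS _] := S_P m; exact: NS.
    by have [NS _] := S_P 0%N; exact: NS.
  apply/seteqP; split => x.
    move=> [n _]; have [_ ->] := S_P n => -[k _ Sx].
    by exists (pickle (n, k)) => //; rewrite pickleK.
  move=> [k _]; case: (unpickle k) => [[m n]|] Sx.
    by exists m => //; have [_ ->] := S_P m; exists n.
  by exists 0%N => //; have [_ ->] := S_P 0%N; exists 0%N.
have mA := mE _ EA; exists A; split => // S NS.
have mS := measurable_supp S.
have [S_ [NS_ AE]] := EA.
have : mu.-negligible (supp S `\` A).
  apply: negligible_setD => //; apply: Amax; last by move=> x; left.
  exists (fun n => if n is m.+1 then S_ m else S); split; first by case.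
  apply/seteqP; split => [x [|Sx]|x [[|n] _ Sx]].
  - by rewrite {1}AE => -[n _ Sx]; exists n.+1.
  - by exists 0%N.
  - by right.
  - by left; rewrite AE; exists n.
by apply: negligibleS => x /= /not_implyP[Sx nAx]; split.
Qed.

Section ess_support.
Variables (S_ : nat -> Aut mu) (A0 : set T).
Hypothesis NS : forall n, N (S_ n).
Hypothesis A0E : A0 = \bigcup_n supp (S_ n).
Hypothesis A0ess : forall S, N S -> {ae mu, forall x, supp S x -> A0 x}.

Lemma exists_small_swap v C : mp_L1 Phi v -> (forall x, v (v x) = x) ->
  measurable C -> (0 < mu C)%E -> {ae mu, forall x, C x -> A0 x} ->
  {ae mu, forall x, C x -> v x <> x} ->
  exists E g, [/\ measurable E, (0 < mu E)%E, forall x, E x -> C x \/ C (v x),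
    forall x, E x -> E (v x) &
    [/\ N (aut g), forall x, E x -> g x = v x & forall x, ~ E x -> g x = x]].
Proof.
move=> Lv vK mC C0 CA Cv.
have [||n n0] := exists_nonnull (A := fun n => supp (S_ n)) mC _ C0.
- by move=> n; exact: measurable_supp.
- by apply: filterS CA => x Ax /Ax; rewrite A0E => -[n _ Sx]; exists n.
have mCn : measurable (C `&` supp (S_ n)).
  by apply: measurableI => //; exact: measurable_supp.
have [|C1 [mC1 C1C C10 C1S]] := exists_displaced sB (f := repr (S_ n)) mCn n0.
  by apply: aeW => x [_].
have [|C2 [mC2 C21 C20 C2v]] := exists_displaced sB (f := v) mC1 C10.
  by apply: filterS Cv => x Cvx /C1C[/Cvx].
have C2S x : C2 x -> ~ C2 ((S_ n) x).
  by move=> /C21 /C1S nC1 /C21.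
have [E [g [mE E0 EC Ev Eg]]] :=
  small_swap_in_normal mD sB hJ aper nN (NS n) Lv vK mC2 C20 C2S C2v.
exists E, g; split => // x /EC[/C21/C1C[]|/C21/C1C[]]; [by left|by right].
Qed.

(** Exhaustion: the invariant sets on which v restricts to an element of N are
    stable under increasing unions, as N is closed. On the complement of one of
    maximal measure, a small piece of v would still belong to N. *)
Lemma involution_in_normal v : mp_L1 Phi v -> (forall x, v (v x) = x) ->
  {ae mu, forall x, v x <> x -> A0 x} -> N (aut v).
Proof.
move=> Lv vK vA.
pose P := [set E : set T | [/\ measurable E, forall x, E x -> E (v x) & exists g,
  [/\ N (aut g), forall x, E x -> g x = v x & forall x, ~ E x -> g x = x]]].
have mv : measurable_fun setT (fun x => D x (v x)) by exact: mD.
have v0 x : (0 <= D x (v x))%E by exact: word_dist_ge0.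
have [||F PF Fmono|E [mE Ev [g [Ng gE gN]]] Emax] :=
    @exists_maximal_measure _ _ _ mu P set0.
- by move=> E [].
- split => //; exists (mp_id mu); split => //; exact: (normal_1 nN).
- have mF n : measurable (F n) by have [] := PF n.
  pose E := \bigcup_n F n.
  have mE : measurable E by exact: bigcupT_measurable.
  have Ev x : E x -> E (v x).
    by move=> [n _ Fx]; exists n => //; have [_ Fv _] := PF n; exact: Fv.
  split => //.
  have Ev' x : E x <-> E (v x) by split => [/Ev //|/Ev]; rewrite vK.
  have [g [gE gN _ /(_ Lv) Lg]] := exists_restriction mD mE Ev'.
  exists g; split => //; apply: normal_closed; split; first exact/mp_L1E.
  move=> e e0; have [r r0 rP] := integral_small mv v0 Lv e0.
  have mEF n : measurable (E `\` F n) by exact: measurableD.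
  have : (mu \o (fun n => E `\` F n)) n @[n --> \oo] --> mu (\bigcap_n (E `\` F n)).
    apply: nonincreasing_cvg_mu => //.
    - by rewrite ltey_eq fin_num_measure.
    - exact: bigcapT_measurable.
    - have Fm : {homo F : m n / (m <= n)%N >-> m `<=` n}.
        apply: homo_leq => //; first by move=> ? ?.
        by move=> Y X Z XY YZ; exact: subset_trans YZ.
      move=> m n /Fm mn; apply/subsetPset => x [Ex nF]; split => // Fx.
      exact/nF/mn.
  have -> : \bigcap_n (E `\` F n) = set0.
    apply/seteqP; split => // x EF.
    by have [[n _ Fx] _] := EF 0%N I; have [_] := EF n I.
  rewrite measure0 => /fine_cvgP[_ /cvgrPdist_lt /(_ r r0)[n _ /(_ n)]] /=.
  rewrite leqnn sub0r normrN => /(_ isT) nr.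
  have {nr} EFr : (mu (E `\` F n) < r%:E)%E.
    rewrite -(@fineK _ (mu (E `\` F n))) ?fin_num_measure// lte_fin.
    by rewrite (le_lt_trans _ nr)// ler_norm.
  have [_ _ [gn [Ngn gnF gnN]]] := PF n.
  exists (aut gn) => //; rewrite L1_dist_aut//.
  apply: le_lt_trans (rP _ (mEF n) EFr); rewrite [leRHS]integral_mkcond.
  apply: ge0_le_integral => //.
  - by move=> x _; exact: word_dist_ge0.
  - exact: mD.
  - exact: measurable_restrict_fun.
  - move=> x _; rewrite patchE; case: ifPn => [/set_mem[Ex nFx]|].
      by rewrite gE// gnN.
    move=> /negP; rewrite inE => nEF.
    have [Fx|nFx] := pselect (F n x).
      by rewrite gnF// gE ?word_distxx//; exists n.
    rewrite gnN// gN ?word_distxx// => Ex; exact: nEF.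
suff vE : {ae mu, forall x, v x <> x -> E x}.
  have -> : aut v = aut g => //.
  apply: aut_eq; apply: filterS vE => x vx.
  have [/gE->//|nEx] := pselect (E x).
  by rewrite gN//; apply: contrapT => /vx.
pose W := [set x | v x <> x] `\` E.
have mW : measurable W.
  apply: measurableD => //.
  rewrite (_ : [set x | v x <> x] = ~` [set x | v x = x]) //.
  by apply: measurableC; apply: (measurable_eqset sB).
have [W0|] := eqVneq (mu W) 0%E.
  move/(negligibleP mu mW) : W0; apply: negligibleS => x /= /not_implyP[vx nEx].
  by split.
rewrite -measure_gt0 => W0; exfalso.
have [||E' [g' [mE' E'0 E'W E'v [Ng' g'E g'N]]]] := exists_small_swap Lv vK mW W0.
- by apply: filterS vA => x vx [/vx].
- by apply: aeW => x [].
have EE' x : E x -> ~ E' x.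
  by move=> Ex /E'W[[]//|[_]]; apply; exact: Ev.
have : (mu (E `|` E') <= mu E)%E.
  apply: Emax; last by move=> x; left.
  split; first exact: measurableU.
    by move=> x [/Ev|/E'v]; [left|right].
  exists (mp_comp g g'); split.
  - by rewrite autM; apply: (normal_M nN).
  - move=> x [Ex|E'x] /=.
      by rewrite g'N ?gE//; exact: EE'.
    rewrite g'E// gN// => /EE'; apply; exact: E'v.
  - by move=> x /not_orP[nEx nE'x] /=; rewrite g'N// gN.
move=> /(negligible_setD mE mE').
have -> : E' `\` E = E'.
  by apply/seteqP; split => [x []//|x E'x]; split => // /EE'.
by move=> /(negligibleP mu mE') E'00; rewrite E'00 ltxx in E'0.
Qed.

(** If a word carried a non-null piece of A0 out of A0, then N would contain the
    swap of a smaller piece with its image, whose support leaves A0. *)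
Lemma ess_support_word w : {ae mu, forall x, A0 (gam w x) -> A0 x}.
Proof.
have mA0 : measurable A0.
  by rewrite A0E; apply: bigcupT_measurable => n; exact: measurable_supp.
pose C := A0 `&` gam (rev w) @^-1` (~` A0).
have mC : measurable C.
  by apply: measurableI => //; apply: measurable_mp_preimage; exact: measurableC.
have wK x : gam w (gam (rev w) x) = x.
  by rewrite -{1}[w]revK (word_mp_rev hJ).
have [C0|] := eqVneq (mu C) 0%E.
  have mCw : measurable (gam w @^-1` C) by exact: measurable_mp_preimage.
  have : mu (gam w @^-1` C) = 0%E by rewrite mp_preserve.
  move=> /(negligibleP mu mCw); apply: negligibleS => x /= /not_implyP[Aw nA].
  by split => //=; rewrite (word_mp_rev hJ).
rewrite -measure_gt0 => C0; exfalso.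
have LJ : mp_L1 Phi (gam (rev w)) by exact: (mp_L1_word hJ mD).
have [x|v [vK Lv vC vC' vN]] := exists_swap mD mC LJ; first by move=> [_ nA] [].
have [||E [g [mE E0 EC Ev [Ng gE gN]]]] := exists_small_swap Lv vK mC C0.
- by apply: aeW => x [].
- by apply: aeW => x Cx; rewrite vC// => xE; have [Ax] := Cx; rewrite /= xE.
have EnA x : E x -> ~ C x -> ~ A0 x.
  move=> Ex nCx; case: (EC _ Ex) => // Cvx.
  by rewrite -(vK x) vC//; have [] := Cvx.
have aux : {ae mu, forall x, E x -> C x}.
  have := A0ess Ng; move: (autE g); apply: filterS2 => x gx sA Ex.
  apply: contrapT => nCx; apply: (EnA _ Ex nCx); apply: sA.
  rewrite /supp /= gx gE// => vx; case: (EC _ Ex) => // Cvx; apply: nCx.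
  by rewrite -vx.
have aux2 : {ae mu, forall x, E (v x) -> C (v x)}.
  exact: (@ae_mp_preimage _ _ _ _ v (fun x => E x -> C x) aux).
have [x Ex [Cx /(_ (Ev _ Ex)) Cvx]] : exists2 x, E x & C x /\ (E (v x) -> C (v x)).
  have := @ae_nonnull _ _ _ mu (fun x => (E x -> C x) /\ (E (v x) -> C (v x))) E mE E0.
  case; first by apply: filterS2 aux aux2 => x; split.
  by move=> x Ex [/(_ Ex) Cx Cvx]; exists x.
by have [_ nA] := Cx; have [Avx _] := Cvx; apply: nA; rewrite /= -vC.
Qed.

End ess_support.

End normal_subgroups.

(** * Elements with a given support *)

Section reconstruction.
Context d (T : measurableType d) (R : realType) (mu : probability T R).
Variable Phi : set (partial_iso mu).
Local Notation D := (word_dist Phi).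
Local Notation dist := (L1_dist Phi).
Local Notation H := (L1_full_group Phi).
Local Notation G := (L1_closure Phi (derived_subgroup H)).
Local Notation F := (involution_group Phi).
Variables (B : (set T)^nat) (J : nat -> mp_bijection mu).
Hypothesis sB : separating B.
Hypothesis hJ : generating_involutions Phi J.
Hypothesis aper : aperiodic Phi.
Hypothesis mD : measurable_distance Phi.
Local Notation gam := (word_mp J).
Implicit Types (S U V : Aut mu) (f g v : mp_bijection mu) (C : set T).

Hint Resolve measurable_mp measurable_Aut : core.

(** Four disjoint copies of a small set inside C carry a 3-cycle, which is a
    commutator of two transpositions. *)
Lemma exists_supported_nontrivial C : measurable C -> (0 < mu C)%E ->
  exists S C', [/\ G S, {ae mu, forall x, supp S x -> C x}, measurable C',
    (0 < mu C')%E & C' `<=` C /\ {ae mu, forall x, C' x -> supp S x}].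
Proof.
move=> mC C0.
have [w1 [C1 [mC1 C1C C10 C1g]]] := exists_return sB hJ aper mC C0.
have [w2 [C2 [mC2 C21 C20 C2a]]] := exists_return sB hJ aper mC1 C10.
set b1 := gam w1 in C1g; set a := gam w2 in C2a.
pose k (p : bool) : mp_bijection mu := if p then b1 else mp_id mu.
have kI p q x y : C1 x -> C1 y -> k p x = k q y -> p = q.
  move=> Cx Cy; have [_ nb1x] := C1g _ Cx; have [_ nb1y] := C1g _ Cy.
  case: p; case: q => //= E; exfalso.
  - by apply: nb1x; rewrite E.
  - by apply: nb1y; rewrite -E.
pose h (i : bool * bool) : mp_bijection mu :=
  if i.2 then mp_comp (k i.1) a else k i.1.
have hC : copies mu C2 h := prod_copies mC2 C21 kI C2a.
have Lh i : mp_L1 Phi (h i).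
  have Lk p : mp_L1 Phi (k p).
    by case: p => //=; [exact: mp_L1_word|exact: mp_L1_id].
  by rewrite /h; case: (i.2) => //; apply: mp_L1_comp => //; exact: mp_L1_word.
have [r rE] := permute_copies_mp hC.
have hin i x : C2 x -> C (h i x).
  move=> Cx; have C1x : C1 (if i.2 then a x else x).
    by case: (i.2); [have [] := C2a _ Cx|exact: C21].
  have -> : h i x = k i.1 (if i.2 then a x else x) by rewrite /h; case: i {C1x} => p [].
  case: (i.1) => /=; first by have [] := C1g _ C1x.
  exact: C1C.
pose x1 := (false, false); pose x2 := (false, true); pose x3 := (true, false).
pose s := [~ tperm x1 x2, tperm x2 x3]%g.
have u3 : uniq [:: x1; x2; x3] by [].
have [s12 s23 s31 _] := commg_tperm u3.
have sV : s^-1%g x1 = x3 by apply: (perm_inj (s := s)); rewrite permKV s31.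
exists (aut (r s)), C2; split => //.
- apply: (derived_sub_closure mD); rewrite (repR hC rE).
  by apply: derived_subgroup_comm; exact: (rep_L1 mD hC Lh rE).
- move: (autE (r s)); apply: filterS => x rx; rewrite /supp /= rx rE => rsx.
  apply: contrapT => nCx; apply: rsx; apply: permute_copies_out => i y Cy hy.
  by apply: nCx; rewrite -hy; exact: hin.
split; first by move=> x /C21/C1C.
move: (autE (r s)); apply: filterS => x rx Cx; rewrite /supp /= rx.
have -> : r s x = b1 x.
  by rewrite rE -[X in permute_copies _ _ _ X]/(h x1 x) (permute_copiesE hC)// sV.
have [_ nb1] := C1g _ (C21 _ Cx) => bx; apply: nb1; rewrite bx.
exact: C21.
Qed.

Variable N : set (Aut mu).
Hypothesis nN : normal_subgroup_of N G.
Hypothesis cN : L1_closed_in Phi N G.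
Variable A : set T.
Hypothesis mA : measurable A.
Hypothesis invA : forall x y, orbit_rel Phi x y -> A x -> A y.
Hypothesis involN : forall v, mp_L1 Phi v -> (forall x, v (v x) = x) ->
  {ae mu, forall x, v x <> x -> A x} -> N (aut v).

Definition cuts_to (u w : Aut mu) : Prop :=
  {ae mu, forall x, (A x -> w x = u x) /\ (~ A x -> w x = x)}.

Lemma full_group_invariant u : H u -> {ae mu, forall x, A x <-> A (u x)}.
Proof.
move=> [fu _]; apply: filterS fu => x xu; split; first exact: invA.
by apply: invA; exact: rst_sym.
Qed.

Lemma ae_and (P Q : T -> Prop) : {ae mu, forall x, P x} ->
  {ae mu, forall x, Q x} -> {ae mu, forall x, P x /\ Q x}.
Proof. by apply: filterS2 => x; split. Qed.

Lemma cuts_to_div u1 u2 w1 w2 : H u2 ->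
  cuts_to u1 w1 -> cuts_to u2 w2 -> cuts_to (u1 * u2^-1)%g (w1 * w2^-1)%g.
Proof.
move=> Hu2 c1 c2; pose g := repr u2.
have [V2 V2E] : exists V : Aut mu, V = (u2^-1)%g by exists (u2^-1)%g.
have [W2 W2E] : exists V : Aut mu, V = (w2^-1)%g by exists (w2^-1)%g.
have HV : H V2 by rewrite V2E; exact: L1_fullV.
have V1 (u V : Aut mu) : V = (u^-1)%g -> {ae mu, forall x, V x = mp_inv (repr u) x}.
  by move=> ->; have := autE (mp_sym (repr u)); rewrite autV aut_repr.
have c1' : {ae mu, forall x, (A (V2 x) -> w1 (V2 x) = u1 (V2 x)) /\
    (~ A (V2 x) -> w1 (V2 x) = V2 x)}.
  exact: (@ae_mp_preimage _ _ _ _ (repr V2)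
    (fun x => (A x -> w1 x = u1 x) /\ (~ A x -> w1 x = x)) c1).
have c2' : {ae mu, forall x, (A (mp_inv g x) -> w2 (mp_inv g x) = u2 (mp_inv g x)) /\
    (~ A (mp_inv g x) -> w2 (mp_inv g x) = mp_inv g x)}.
  exact: (@ae_mp_preimage _ _ _ _ (mp_sym g)
    (fun x => (A x -> w2 x = u2 x) /\ (~ A x -> w2 x = x)) c2).
have e1 := Aut_mulE u1 V2; have e2 := Aut_mulE w1 W2.
have iA := full_group_invariant HV.
have a1 : {ae mu, forall x, mp_inv g x = V2 x}.
  by move: (V1 _ _ V2E); apply: filterS => x ->.
have a2 : {ae mu, forall x, (A x -> W2 x = V2 x) /\
                            (~ A x -> W2 x = x)}.
  move: (V1 _ _ W2E) c2 (ae_and (ae_and c2' a1) iA).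
  apply: filterS3 => x w2V [_ c2x] [[[c2a _] gx] [Ax _]]; split.
    move=> /Ax; rewrite -gx => /c2a h; rewrite w2V.
    apply: (mp_inj (f := repr w2)); rewrite mp_invK.
    by rewrite [RHS]h -[u2 _]/(g _) mp_invK.
  by move=> /c2x h; rewrite w2V; apply: (mp_inj (f := repr w2)); rewrite mp_invK [RHS]h.
rewrite /cuts_to -V2E -W2E.
move: (ae_and e1 e2) (ae_and a2 iA) (ae_and c1 c1').
apply: filterS3 => x [-> ->] [[a2A a2N] [Ax nAx]] [[_ c1x] [c1A _]]; split.
  by move=> xA; rewrite a2A// c1A//; exact: Ax.
by move=> xN; rewrite a2N// c1x.
Qed.

(** Cutting to A is compatible with products since A is invariant, and cutting an
    involution gives an involution. *)
Lemma involution_group_cut u : F u -> exists2 w, N w & cuts_to u w.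
Proof.
have gN : group_closed (mem N) by have [] := nN.
suff FQ : F `<=` [set u | H u /\ exists2 w, N w & cuts_to u w] by move=> /FQ[].
move=> {}u; apply; split.
  split.
    rewrite inE /=; split; first by apply: set_mem; case: (L1_full_group_closed mD).
    exists 1%g; first exact: (normal_1 nN).
    by apply: filterS (autE (mp_id mu)) => x h; split => // _; exact: h.
  move=> u1 u2 /[!inE] -[H1 [w1 N1 c1]] [H2 [w2 N2 c2]]; split.
    by apply: L1_fullM => //; exact: L1_fullV.
  exists (w1 * w2^-1)%g; last exact: cuts_to_div.
  by apply: (normal_M nN) => //; exact: (normal_V nN).
move=> _ [v [vK Lv ->]]; split; first exact/mp_L1E.
pose E := A `&` v @^-1` A.
have mE : measurable E by apply: measurableI => //; exact: measurable_mp_preimage.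
have Ev x : E x <-> E (v x) by split; rewrite /E /= vK => -[].
have [g [gE gN' _ /(_ Lv) Lg]] := exists_restriction mD mE Ev.
exists (aut g).
  apply: involN => //.
    move=> x; have [Ex|nEx] := pselect (E x); last by rewrite !gN'.
    by rewrite (gE x)// gE ?vK//; exact: (Ev x).1.
  apply: aeW => x gx; have [[]//|nEx] := pselect (E x).
  by exfalso; apply: gx; exact: gN'.
have := full_group_invariant ((mp_L1E mD v).1 Lv).
move: (autE v) (autE g); apply: filterS3 => x vx gx; rewrite vx gx => iA; split.
  by move=> Ax; apply: gE; split => //; exact/iA.
by move=> nAx; apply: gN' => -[].
Qed.

(** An element of the closure is a limit of products of involutions; cutting the
    approximations to A stays within N and does not increase the distance to an
    element supported in A. *)
Lemma supported_in_sub : supported_in G A `<=` N.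
Proof.
move=> S [GS SA]; apply: (normal_closed mD nN cN).
have [HS cS] := derived_sub_involution_closure mD sB GS.
split => // e /cS[u Fu uS].
have [w Nw cuw] := involution_group_cut Fu.
exists w => //; apply: le_lt_trans uS.
apply: ae_ge0_le_integral => //.
- by move=> x _; exact: word_dist_ge0.
- exact: mD.
- by move=> x _; exact: word_dist_ge0.
- exact: mD.
move: SA cuw; apply: filterS2 => x SA [wA wN] _.
have [/wA -> //|nAx] := pselect (A x).
rewrite wN// (_ : S x = x) ?word_distxx ?word_dist_ge0//.
by apply: contrapT => Sx; apply: nAx; exact: SA.
Qed.

End reconstruction.

(** * The classification of closed normal subgroups *)

Theorem theorem3p24 (d : measure_display) (T : measurableType d)
    (R : realType) (mu : probability T R) (Phi : set (partial_iso mu)) :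
  standard_borel R T -> non_atomic mu ->
  is_graphing Phi -> aperiodic Phi ->
  let DPhi := L1_closure Phi (derived_subgroup (L1_full_group Phi)) in
  forall N : set (Aut mu),
    normal_subgroup_of N DPhi -> L1_closed_in Phi N DPhi ->
    exists A : set T,
      [/\ measurable A, graphing_invariant Phi A, N = supported_in DPhi A &
          forall B : set T, measurable B -> graphing_invariant Phi B ->
            N = supported_in DPhi B -> {ae mu, forall x, A x <-> B x}].
Proof.
move=> /standard_borel_separating[B sB] _ grPhi aper DPhi N nN cN.
have [J hJ] := exists_generating_involutions sB grPhi.
have mD := measurable_word_dist hJ (T' := T) sB.
have [A0 [[S_ [NS A0E]] mA0 A0ess]] := exists_ess_support sB nN.
pose A := \bigcup_(w in [set: seq nat]) (word_mp J w @^-1` A0).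
have mA : measurable A.
  apply: countable_bigcupT_measurable; first exact: countableP.
  by move=> w; exact: measurable_mp_preimage.
have A0A : A0 `<=` A by move=> x Ax; exists [::].
have AA0 : {ae mu, forall x, A x -> A0 x}.
  have := @ae_foralln _ _ _ mu
    (fun k x => A0 (word_mp J (odflt [::] (unpickle k)) x) -> A0 x).
  move=> /(_ (fun k => ess_support_word sB hJ aper mD nN NS A0E A0ess _)).
  apply: filterS => x h [w _ Aw]; apply: (h (pickle w)).
  by rewrite pickleK.
have invA x y : orbit_rel Phi x y -> A x -> A y.
  move=> /(orbit_word hJ)[u ->] [w _ Aw]; exists (w ++ rev u) => //.
  by rewrite /= word_mp_cat (word_mp_rev hJ).
have NA : N = supported_in DPhi A.
  apply/seteqP; split => [S NS'|].
    split; first by have [_ NG _] := nN; exact: NG.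
    by apply: filterS (A0ess _ NS') => x Sx /Sx/A0A.
  apply: (supported_in_sub sB mD nN cN mA invA) => v Lv vK vA.
  apply: (involution_in_normal sB hJ aper mD nN cN NS A0E) => //.
  by apply: filterS2 vA AA0 => x vx Ax /vx/Ax.
exists A; split => //; first by exists A => //; exact: aeW.
move=> B' mB' _ NB'.
have AB' : {ae mu, forall x, A x -> B' x}.
  have NSB n : {ae mu, forall x, supp (S_ n) x -> B' x}.
    by have : N (S_ n) by []; rewrite {1}NB' => -[].
  apply: filterS2 AA0 (ae_foralln NSB) => x Ax nB /Ax.
  by rewrite A0E => -[n _]; exact: nB.
have B'A : mu (B' `\` A) = 0%E.
  have mBA : measurable (B' `\` A) by exact: measurableD.
  have [//|] := eqVneq (mu (B' `\` A)) 0%E.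
  rewrite -measure_gt0 => BA0; exfalso.
  have [S [C [GS SBA mC C0 [CBA CS]]]] := exists_supported_nontrivial sB hJ aper mD mBA BA0.
  have : N S by rewrite NB'; split => //; apply: filterS SBA => x Sx /Sx[].
  rewrite NA => -[_ SA].
  have [x Cx [Cx1 Sx]] : exists2 x, C x & (C x -> supp S x) /\ (supp S x -> A x).
    by apply: (@ae_nonnull _ _ _ mu) => //; apply: filterS2 CS SA => x; split.
  by have [_ []] := CBA _ Cx; exact/Sx/Cx1.
have mBA : measurable (B' `\` A) by exact: measurableD.
move/(negligibleP mu mBA) : B'A => B'A.
have {}B'A : {ae mu, forall x, B' x -> A x}.
  by apply: negligibleS B'A => x /= /not_implyP[].
by apply: filterS2 AB' B'A => x; split.
Qed.
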